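(* For all $1<p<+\infty$ and $n\in\mathbb{N}$, $$\mathcal{D}_p^n\cup\left(\mathcal{L}^n\circ\mathcal{D}_p\right)\subseteq\mathcal{D}_{as}^n.$$
   Context: All Banach spaces are over a fixed field $\mathbb{K}=\mathbb{R}$ or $\mathbb{C}$; $E'$ is the topological dual of $E$. $\mathcal{L}^n$ is the class of all continuous $n$-linear operators between Banach spaces. All classes below consist of continuous ($n$-)linear operators between arbitrary Banach spaces, and inclusion means inclusion of classes of operators. Sequence spaces, for a Banach space $E$: - $\ell_q(E)$, $1\le q<\infty$: absolutely $q$-summable $E$-valued sequences with the usual norm. - $\ell_q^w(E)$, $1\le q<\infty$: weakly $q$-summable $E$-valued sequences with norm $\|(x_j)_j\|_{w,q}=\sup_{\varphi\in B_{E'}}\|(\varphi(x_j))_j\|_q$. - $\ell_q\langle E\rangle$, $1<q<\infty$, $\frac1q+\frac1{q^*}=1$ (Cohen strongly $q$-summable sequences): all $(x_j)_j\in E^{\mathbb{N}}$ with $\|(x_j)_j\|_{\ell_q\langle E\rangle}:=\sup\{\|(\varphi_j(x_j))_j\|_1:(\varphi_j)_j\in B_{\ell_{q^*}^w(E')}\}<\infty$. - $\mathrm{Rad}(E)$: sequences $(x_j)_j$ in $E$ such that $\sum_jr_j(t)x_j$ converges for almost every $t\in[0,1]$ (equivalently $\sum_jr_jx_j$ converges in $L_2([0,1];E)$), where $(r_j)_j$ are the Rademacher functions, with norm $\left(\int_0^1\|\sum_{j=1}^\infty r_j(t)x_j\|^2dt\right)^{1/2}$. Operator classes: - $\mathcal{D}_p^n$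 (Cohen strongly $p$-summing $n$-linear operators): continuous $n$-linear $A\colon E_1\times\cdots\times E_n\to F$ such that $(A(x_j^1,\ldots,x_j^n))_{j=1}^\infty\in\ell_p\langle F\rangle$ whenever $(x_j^m)_{j=1}^\infty\in\ell_{np}(E_m)$, $m=1,\ldots,n$. In the linear case $n=1$ one writes $\mathcal{D}_p=\mathcal{D}_p^1$ (linear operators sending $\ell_p(E)$ into $\ell_p\langle F\rangle$). - $\mathcal{L}^n\circ\mathcal{D}_p$: $n$-linear operators $A\colon E_1\times\cdots\times E_n\to F$ of the form $A=B\circ(u_1,\ldots,u_n)$, where each $u_j$ is a linear operator from $E_j$ to some Banach space $G_j$ belonging to $\mathcal{D}_p$ and $B\colon G_1\times\cdots\times G_n\to F$ is a continuous $n$-linear operator. - $\mathcal{D}_{as}^n$ (Cohen almost summing $n$-linear operators): continuous $n$-linear $A\colon E_1\times\cdots\times E_n\to F$ such that $(A(x_j^1,\ldots,x_j^n))_{j=1}^\infty\in\ell_2\langle F\rangle$ whenever $(x_j^m)_{j=1}^\infty\in\mathrm{Rad}(E_m)$, $m=1,\ldots,n$. *)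

(* Defs.v *)
From HB Require Import structures.
From mathcomp Require Import all_boot all_order all_algebra.
From mathcomp Require Import all_classical all_reals all_analysis.
From mathcomp Require Import complex.

Set Implicit Arguments.
Unset Strict Implicit.
Unset Printing Implicit Defensive.

Import Order.TTheory GRing.Theory Num.Theory.
Import numFieldNormedType.Exports.

Local Open Scope classical_set_scope.
Local Open Scope ring_scope.

Variant scalar_kind := RealScalars | ComplexScalars.

Definition scalar_field (R : realType) (k : scalar_kind) : numFieldType :=
  match k with
  | RealScalars => R
  | ComplexScalars => R[i]
  end.

Definition scalar_re (R : realType) (k : scalar_kind) : scalar_field R k -> R :=
  match k with
  | RealScalars => id
  | ComplexScalars => @complex.Re R
  end.

Definition scalar_of (R : realType) (k : scalar_kind) : R -> scalar_field R k :=
  match k with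
  | RealScalars => id
  | ComplexScalars => real_complex R
  end.

(* In a normed module over K, `|x| is an element of K (a nonnegative one);
   rnorm is the same norm as a real number. *)
Definition rnorm (R : realType) (k : scalar_kind)
    (V : normedModType (scalar_field R k)) (x : V) : R :=
  scalar_re `|x|.

Section rnorm_theory.
Context {R : realType} {k : scalar_kind}.
Implicit Types V : normedModType (scalar_field R k).

Lemma scalar_reK (a : scalar_field R k) : 0 <= a -> scalar_of k (scalar_re a) = a.
Proof. by case: k a => //= -[a b]; rewrite lecE /= => /andP[/eqP ->]. Qed.

Lemma scalar_ofD (a b : R) :
  scalar_of k (a + b) = scalar_of k a + scalar_of k b.
Proof. by case: k => //=; rewrite rmorphD. Qed.

Lemma scalar_ofM (a b : R) :
  scalar_of k (a * b) = scalar_of k a * scalar_of k b.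
Proof. by case: k => //=; rewrite rmorphM. Qed.

Lemma ler_scalar_of (a b : R) : (scalar_of k a <= scalar_of k b) = (a <= b).
Proof. by case: k => //=; rewrite lecR. Qed.

Lemma scalar_of0 : scalar_of k 0 = 0 :> scalar_field R k.
Proof. by case: k. Qed.

Lemma scalar_of1 : scalar_of k 1 = 1 :> scalar_field R k.
Proof. by case: k. Qed.

Lemma scalar_ofK (a : R) : scalar_re (scalar_of k a) = a.
Proof. by case: k. Qed.

Lemma scalar_of_rnorm V (x : V) : scalar_of k (rnorm x) = `|x|.
Proof. exact/scalar_reK/normr_ge0. Qed.

Lemma rnorm_ge0 V (x : V) : 0 <= rnorm x.
Proof. by rewrite -ler_scalar_of scalar_of_rnorm scalar_of0. Qed.

Lemma rnorm0 V : rnorm (0 : V) = 0.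
Proof. by rewrite /rnorm normr0 -scalar_of0 scalar_ofK. Qed.

Lemma ler_rnormD V (x y : V) : rnorm (x + y) <= rnorm x + rnorm y.
Proof. by rewrite -ler_scalar_of scalar_ofD !scalar_of_rnorm ler_normD. Qed.

Lemma rnormZ V (a : scalar_field R k) (x : V) :
  rnorm (a *: x) = rnorm (a : (scalar_field R k)^o) * rnorm x.
Proof.
rewrite -[LHS](@scalar_ofK) -[RHS](@scalar_ofK); congr scalar_re.
by rewrite scalar_ofM !scalar_of_rnorm normrZ.
Qed.

End rnorm_theory.

Section dual.
Context {R : realType} {k : scalar_kind} (V : normedModType (scalar_field R k)).
Local Notation K := (scalar_field R k).

Definition dual_pred : {pred V -> K^o} :=
  fun f => `[< linear f /\ continuous f >].

Record dual_space := Dual {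
  dual_fun :> V -> K^o;
  dual_funP : dual_fun \in dual_pred
}.

HB.instance Definition _ := [isSub of dual_space for dual_fun].
HB.instance Definition _ := [Choice of dual_space by <:].

Lemma dual_submod_closed : submod_closed dual_pred.
Proof.
split=> [|a f g /asboolP[lf cf] /asboolP[lg cg]]; apply/asboolP; split.
- by move=> b x y; rewrite -[RHS]/(b *: (0 : K^o) + 0) scaler0 addr0.
- exact: cst_continuous.
- move=> b x y.
  rewrite -[LHS]/(a *: f (b *: x + y) + g (b *: x + y)).
  rewrite -[RHS]/(b *: (a *: f x + g x) + (a *: f y + g y)).
  by rewrite lf lg !scalerDr !scalerA mulrC addrACA.
- by move=> x; apply: cvgD; [apply: cvgZr; exact: cf|exact: cg].
Qed.

HB.instance Definition _ := GRing.isSubmodClosed.Build K (V -> K^o) dual_pred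
  dual_submod_closed.
HB.instance Definition _ := [SubChoice_isSubLmodule of dual_space by <:].

Lemma dualP (f : dual_space) : linear f /\ continuous f.
Proof. exact/asboolP/dual_funP. Qed.

Lemma dual_bounded (f : dual_space) :
  exists M : R, forall x, rnorm x <= 1 -> rnorm (f x) <= M.
Proof.
have [lf cf] := dualP f.
pose lin := GRing.isLinear.Build K V K^o *:%R f lf.
pose g : {linear V -> K^o} := HB.pack (dual_fun f) lin.
have /linear_boundedP/pinfty_ex_gt0[M M0 fM] : bounded_near g (nbhs 0).
  exact/linear_bounded_continuous.
exists (scalar_re M) => x x1.
rewrite -(@ler_scalar_of R k) scalar_of_rnorm scalar_reK ?(ltW M0)//.
apply: (le_trans (fM x)); rewrite ler_piMr ?(ltW M0)// -scalar_of_rnorm.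
by rewrite -(@scalar_of1 R k) ler_scalar_of.
Qed.

Definition dual_norm (f : dual_space) : K :=
  scalar_of k (sup [set rnorm (f x) | x in [set x : V | rnorm x <= 1]]).

Let dual_ball_has_sup (f : dual_space) :
  has_sup [set rnorm (f x) | x in [set x : V | rnorm x <= 1]].
Proof.
split; first by exists (rnorm (f 0)), 0 => //=; rewrite rnorm0 ler01.
have [M fM] := dual_bounded f.
by exists M => _ [x /= x1 <-]; exact: fM.
Qed.

Lemma dual_norm_ub (f : dual_space) (x : V) :
  rnorm x <= 1 -> scalar_of k (rnorm (f x)) <= dual_norm f.
Proof.
move=> x1; rewrite ler_scalar_of; apply: ub_le_sup; last by exists x.
exact: (dual_ball_has_sup f).2.
Qed.

Lemma dual_norm_le (f : dual_space) (M : R) :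
  (forall x, rnorm x <= 1 -> rnorm (f x) <= M) -> dual_norm f <= scalar_of k M.
Proof.
move=> fM; rewrite ler_scalar_of; apply: ge_sup.
  exact: (dual_ball_has_sup f).1.
by move=> _ [x /= x1 <-]; exact: fM.
Qed.

Lemma ler_dual_normD (f g : dual_space) :
  dual_norm (f + g) <= dual_norm f + dual_norm g.
Proof.
rewrite -scalar_ofD; apply: dual_norm_le => x x1.
rewrite (le_trans (ler_rnormD _ _))// lerD// -(@ler_scalar_of R k);
  exact: dual_norm_ub.
Qed.

Let ler_dual_normZ (a : K) (f : dual_space) :
  dual_norm (a *: f) <= `|a| * dual_norm f.
Proof.
rewrite -(scalar_of_rnorm (a : K^o)) -scalar_ofM.
apply: dual_norm_le => x x1; rewrite rnormZ ler_wpM2l ?rnorm_ge0//.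
by rewrite -(@ler_scalar_of R k) dual_norm_ub.
Qed.

Lemma dual_normZ (a : K) (f : dual_space) :
  dual_norm (a *: f) = `|a| * dual_norm f.
Proof.
have [->|a0] := eqVneq a 0.
  apply/le_anti; rewrite ler_dual_normZ normr0 mul0r /= -scalar_of0.
  apply: le_trans (@dual_norm_ub _ 0 _); rewrite ?rnorm0 ?ler01//.
  by rewrite ler_scalar_of rnorm_ge0.
apply/le_anti; rewrite ler_dual_normZ /= -ler_pdivlMl ?normr_gt0//.
by rewrite -normfV -{1}[f](scalerK a0) ler_dual_normZ.
Qed.

Lemma dual_norm_eq0 (f : dual_space) : dual_norm f = 0 -> f = 0.
Proof.
move=> f0; apply/val_inj/funext => x /=.
have [lf _] := dualP f.
have f00 : f 0 = 0.
  by have /= := lf (-1) 0 0; rewrite scaler0 addr0 scaleN1r addNr.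
have [->|x0] := eqVneq x 0; first exact: f00.
have xE : x = `|x| *: (`|x|^-1 *: x).
  by rewrite scalerA divff ?scale1r// normr_eq0.
have /(dual_norm_ub f) : rnorm (`|x|^-1 *: x) <= 1.
  rewrite -(@ler_scalar_of R k) scalar_of_rnorm scalar_of1 normrZ normfV.
  by rewrite normr_id mulVf ?normr_eq0.
rewrite f0 scalar_of_rnorm normr_le0 => /eqP fx0.
by have := lf `|x| (`|x|^-1 *: x) 0; rewrite addr0 -xE fx0 f00 scaler0 addr0.
Qed.

HB.instance Definition _ := Lmodule_isNormed.Build K dual_space
  ler_dual_normD dual_normZ dual_norm_eq0.

End dual.

Section sequence_spaces.
Context {R : realType} {k : scalar_kind}.
Implicit Types V : normedModType (scalar_field R k).

Definition lq_summable V (q : R) (x : nat -> V) : Prop :=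
  (\sum_(0 <= j <oo) (rnorm (x j) `^ q)%:E < +oo)%E.

Definition weak_norm V (q : R) (x : nat -> V) : \bar R :=
  ereal_sup [set ((\sum_(0 <= j <oo) (rnorm (f (x j)) `^ q)%:E) `^ q^-1)%E
            | f in [set f : dual_space V | rnorm f <= 1]].

Definition conj_exponent (q : R) : R := q / (q - 1).

Definition cohen_norm V (q : R) (x : nat -> V) : \bar R :=
  ereal_sup [set (\sum_(0 <= j <oo) (rnorm (f j (x j)))%:E)%E
            | f in [set f : nat -> dual_space V |
                     (weak_norm (conj_exponent q) f <= 1)%E]].

Definition cohen_summable V (q : R) (x : nat -> V) : Prop :=
  (cohen_norm q x < +oo)%E.

(* r_{j+1}(t) = sign (sin (2^{j+1} pi t)): sequences are indexed from 0. *)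
Definition rademacher (j : nat) (t : R) : int :=
  sgz (sin (2 ^+ j.+1 * pi * t)).

Definition rad V (x : nat -> V) : Prop :=
  {ae (@lebesgue_measure R), forall t, `[0, 1]%classic t ->
    cvgn (series (fun j => (rademacher j t)%:~R *: x j))}.

End sequence_spaces.

Section operator_classes.
Context {R : realType} {k : scalar_kind}.
Local Notation K := (scalar_field R k).
Local Notation banach := (completeNormedModType K).

Definition continuous_multilinear n (E : 'I_n -> banach) (F : banach) :
    set ((forall i, E i) -> F) :=
  [set A : (forall i, E i) -> F | (forall (i : 'I_n) (x : forall j, E j),
              linear (fun y : E i => A (dfwith x i y)))
           /\ continuous (A : prod_topology E -> F)].

Definition cohen_operator (p : R) (E F : banach) : set (E -> F) :=
  [set u | [/\ linear u, continuous u &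
    forall x : nat -> E, lq_summable p x -> cohen_summable p (u \o x)]].

Definition cohen_multilinear (p : R) n (E : 'I_n -> banach) (F : banach) :
    set ((forall i, E i) -> F) :=
  [set A : (forall i, E i) -> F | continuous_multilinear A /\
    forall x : forall i, nat -> E i,
      (forall i, lq_summable (n%:R * p) (x i)) ->
      cohen_summable p (fun j => A (fun i => x i j))].

Definition multilinear_comp_cohen (p : R) n (E : 'I_n -> banach) (F : banach) :
    set ((forall i, E i) -> F) :=
  [set A : (forall i, E i) -> F |
    exists (G : 'I_n -> banach) (u : forall i, E i -> G i)
      (B : (forall i, G i) -> F),
    [/\ forall i, cohen_operator p (u i), continuous_multilinear B &
        forall x, A x = B (fun i => u i (x i))]].

Definition cohen_almost_summing n (E : 'I_n -> banach) (F : banach) :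
    set ((forall i, E i) -> F) :=
  [set A : (forall i, E i) -> F | continuous_multilinear A /\
    forall x : forall i, nat -> E i,
      (forall i, rad (x i)) ->
      cohen_summable 2 (fun j => A (fun i => x i j))].

End operator_classes.

Arguments continuous_multilinear {R k n} E F.
Arguments cohen_operator {R k} p E F.
Arguments cohen_multilinear {R k} p {n} E F.
Arguments multilinear_comp_cohen {R k} p {n} E F.
Arguments cohen_almost_summing {R k n} E F.

(* Main.v *)
From HB Require Import structures.
Require Import Defs.
From mathcomp Require Import all_boot all_order all_algebra.
From mathcomp Require Import all_classical all_reals all_analysis.
From mathcomp Require Import zify ring lra.

Import Order.TTheory GRing.Theory Num.Theory.
Import numFieldNormedType.Exports.

Local Open Scope classical_set_scope.
Local Open Scope ring_scope.

Set Implicit Arguments.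
Unset Strict Implicit.
Unset Printing Implicit Defensive.

(** The argument rests on one sign-averaging identity.  Let A be n-linear, let
x^1, ..., x^n be finite sequences of length N and phi_1, ..., phi_N functionals
on F.  For independent random sign vectors theta^1, ..., theta^n in {-1, 1}^N
put X^m = sum_j theta^m_j x^m_j and
Phi = sum_j (theta^1_j ... theta^n_j) phi_j.  Independence kills all the cross
terms and gives (sign_average)

  sum_j phi_j (A (x^1_j, ..., x^n_j)) = E [Phi (A (X^1, ..., X^n))].

The right-hand side is a sum over the finite family of sign patterns, so a
Cohen strongly p-summing A can be applied to that family.  What has to be
controlled is

- E |X^m|^(np), uniformly in N.  For x^m in Rad(E_m) the partial sums are
  almost surely bounded, and the Kahane inequality (kahane_tail) turns this
  bound in probability into bounds on all moments (rad_moment);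
- the weak q-norm of the family Phi, with 1/p + 1/q = 1.  For a functional g in
  the unit ball of F'' it is a moment of the scalar sign sum
  sum_j theta_j g(phi_j), which the Khinchin inequality (khinchin) bounds in
  terms of sum_j |g(phi_j)|^2 <= 1;
- the constant of A.  The definition of a Cohen strongly p-summing operator is
  only qualitative; gluing countably many bad sequences into one shows that it
  is automatically uniform on bounded sets (cohen_multilinear_bound).

Together they bound sum_j |phi_j (A (x_j))| uniformly in N and in phi, which is
the assertion for the class D_p^n (cohen_multilinear_almost_summing).

For A = B o (u_1, ..., u_n) with all u_m in D_p, the case n = 1 just obtained
shows that each y^m = (u_m (x^m_j))_j lies in l_2<G_m>.  If n = 1, composing
with B only pulls weakly 2-summable functionals back along a bounded linear map
(unilinear_image).  If n >= 2, testing y^2 against the bounded functionals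
phi_j (B (g_j, ., y^3_j, ...)) with almost norming g_j shows that the norms of
the functionals phi_j (B (., y^2_j, y^3_j, ...)) are square summable; these are
then admissible test functionals for y^1 (multilinear_image). *)

(** * Averages over random signs *)

Section resampling.
Context {I T : finType}.

Definition resample (f : {ffun I -> T}) (i : I) (s : T) : {ffun I -> T} :=
  [ffun i' => if i' == i then s else f i'].

(** Redrawing one coordinate does not change an average: the map swapping the
redrawn value with the old one is an involution of the pairs (f, s).  This
replaces both the Fubini theorem and the independence of the coordinates. *)
Lemma sum_resample (W : nmodType) (i : I) (h : {ffun I -> T} -> W) :
  \sum_f \sum_s h (resample f i s) = (\sum_f h f) *+ #|T|.
Proof.
rewrite pair_big /=.
pose swap (u : {ffun I -> T} * T) := (resample u.1 i u.2, u.1 i).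
have swapK : involutive swap.
  move=> [f s]; rewrite /swap /=; congr pair; last by rewrite ffunE eqxx.
  by apply/ffunP => j; rewrite !ffunE; case: eqP => // ->.
rewrite (reindex_inj (inv_inj swapK)) /=.
rewrite (eq_bigr (fun u => h u.1)) => [|[f s] _ /=]; last first.
  congr h; apply/ffunP => j; rewrite !ffunE.
  by case: eqP => // ->.
rewrite -(pair_big predT predT (fun f s => h f)) /= -sumrMnl.
by apply: eq_bigr => f _; rewrite sumr_const.
Qed.

End resampling.

Section sign_averages.
Context {R : realType}.

(** The mean of F at s plus the random sum of the entries of xs with independent
signs.  The recursion on the list makes stopping-time arguments inductions. *)
Fixpoint signavg (V : zmodType) (xs : seq V) (F : V -> R) (s : V) : R :=
  if xs is x :: xs' then (signavg xs' F (s + x) + signavg xs' F (s - x)) / 2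
  else F s.

Section zmod.
Context {V : zmodType}.
Implicit Types (xs : seq V) (F G : V -> R) (s c : V).

Lemma signavg_cat xs ys F s :
  signavg (xs ++ ys) F s = signavg xs (signavg ys F) s.
Proof. by elim: xs s => //= x xs IH s; rewrite !IH. Qed.

Lemma eq_signavg F G xs s : F =1 G -> signavg xs F s = signavg xs G s.
Proof. by move=> FG; elim: xs s => //= x xs IH s; rewrite !IH. Qed.

Lemma le_signavg F G xs s :
  (forall v, F v <= G v) -> signavg xs F s <= signavg xs G s.
Proof.
by move=> FG; elim: xs s => //= x xs IH s; rewrite ler_wpM2r// lerD.
Qed.

Lemma signavg_cst xs (a : R) s : signavg xs (fun=> a) s = a.
Proof. by elim: xs s => //= x xs IH s; rewrite !IH; lra. Qed.

Lemma signavgD xs F G s :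
  signavg xs (fun v => F v + G v) s = signavg xs F s + signavg xs G s.
Proof. by elim: xs s => //= x xs IH s; rewrite !IH; lra. Qed.

Lemma signavgZ xs (a : R) F s :
  signavg xs (fun v => a * F v) s = a * signavg xs F s.
Proof. by elim: xs s => //= x xs IH s; rewrite !IH; lra. Qed.

Lemma signavg_sum xs n (F : 'I_n -> V -> R) s :
  signavg xs (fun v => \sum_i F i v) s = \sum_i signavg xs (F i) s.
Proof.
elim: xs s => //= x xs IH s; rewrite !IH -big_split/= mulr_suml.
by [].
Qed.

(** The symmetry of the sign distribution. *)
Lemma signavg_reflect xs F c s :
  signavg xs (fun v => F (c - v)) s = signavg xs F (c - s).
Proof.
elim: xs s => //= x xs IH s; rewrite !IH addrC; congr (_ / 2).
by rewrite !opprD opprK !addrA.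
Qed.

Lemma signavg_shift xs F c s :
  signavg xs (fun v => F (c + v)) s = signavg xs F (c + s).
Proof. by elim: xs s => //= x xs IH s; rewrite !IH !addrA. Qed.

End zmod.

End sign_averages.

(** * The Kahane inequality *)

Section kahane.
Context {R : realType} {k : scalar_kind} {V : normedModType (scalar_field R k)}.
Implicit Types (xs ys : seq V) (r : R) (s : V).

Lemma rnormN (v : V) : rnorm (- v) = rnorm v.
Proof. by rewrite /rnorm normrN. Qed.

Lemma rnorm_scalar_of (a : R) :
  0 <= a -> rnorm (scalar_of k a : (scalar_field R k)^o) = a.
Proof.
move=> a0; rewrite /rnorm [X in scalar_re X]ger0_norm ?scalar_ofK//.
by rewrite -(@scalar_of0 R k) ler_scalar_of.
Qed.

(** An indicator function with values in R, so that probabilities are averages. *)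
Definition exceeds r (v : V) : R := (r < rnorm v)%R%:R.

Definition tail_prob xs r : R := signavg xs (exceeds r) 0.

Lemma exceeds_ge0 r v : 0 <= exceeds r v. Proof. exact: ler0n. Qed.

Lemma exceedsN r v : exceeds r (- v) = exceeds r v.
Proof. by rewrite /exceeds rnormN. Qed.

Lemma exceedsD r v w : exceeds (r + r) (v + w) <= exceeds r v + exceeds r w.
Proof.
rewrite /exceeds; case: (ltP r (rnorm v)) => vr.
  by rewrite ler_wpDr ?ler0n// lern1 leq_b1.
case: (ltP r (rnorm w)) => wr; first by rewrite add0r lern1 leq_b1.
rewrite addr0 ltNge (le_trans (ler_rnormD _ _))//; lra.
Qed.

(** Since 2 v = (w + v) - (w - v), one of the two points w + v, w - v is at least
as far from the origin as v: this is where symmetry yields maximal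
inequalities. *)
Lemma exceeds_double r v w : exceeds r v <= exceeds r (w + v) + exceeds r (w - v).
Proof.
rewrite /exceeds; case: (ltP r (rnorm v)) => vr; last by rewrite addr_ge0.
have [wv|wv] := ltP r (rnorm (w + v)); first by rewrite lerDl.
rewrite (_ : (r < _) = true) ?add0r//.
have -> : w - v = - (v - w) by rewrite opprB.
rewrite rnormN.
have : rnorm (v + v) <= rnorm (w + v) + rnorm (v - w).
  have -> : v + v = (w + v) + (v - w).
    by rewrite [w + v]addrC [v - w]addrC addrA addrK.
  exact: ler_rnormD.
have -> : v + v = 2%:R *: v by rewrite scaler_nat mulr2n.
have -> : 2%:R = scalar_of k 2 :> scalar_field R k.
  by rewrite -[2 in RHS]/(1 + 1) scalar_ofD scalar_of1.
rewrite rnormZ rnorm_scalar_of//.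
lra.
Qed.

Lemma tail_ge0 xs r : 0 <= tail_prob xs r.
Proof.
by rewrite -(signavg_cst xs (0 : R) 0); apply: le_signavg => v; exact: exceeds_ge0.
Qed.

(** Condition on the signs of xs: for a fixed value s of their contribution, the
contribution of ys is symmetric and exceeds_double applies to s. *)
Lemma tail_suffix xs ys r : tail_prob ys r <= 2 * tail_prob (xs ++ ys) r.
Proof.
rewrite /tail_prob signavg_cat.
have step s : tail_prob ys r <= signavg ys (exceeds r) s + signavg ys (exceeds r) (- s).
  have -> : signavg ys (exceeds r) s = signavg ys (fun v => exceeds r (s + v)) 0.
    by rewrite signavg_shift addr0.
  have -> : signavg ys (exceeds r) (- s) = signavg ys (fun v => exceeds r (s - v)) 0.
    rewrite signavg_reflect subr0.
    rewrite -(eq_signavg _ _ (@exceedsN r)).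
    rewrite (eq_signavg (G := fun v => exceeds r (0 - v))) => [|v].
      by rewrite signavg_reflect sub0r opprK.
    by rewrite sub0r.
  rewrite -signavgD; apply: le_signavg => v; exact: exceeds_double.
rewrite -[leLHS](signavg_cst xs _ 0).
apply: (le_trans (le_signavg _ _ step)); rewrite signavgD.
rewrite (eq_signavg (F := fun v => signavg ys _ (- v))
  (G := fun v => signavg ys (exceeds r) (0 - v))) => [|v]; last by rewrite sub0r.
by rewrite signavg_reflect subr0 mulrDl mul1r.
Qed.

(** The probability that some partial sum, starting from s, leaves the ball of
radius r: the recursion stops at the first exit. *)
Fixpoint hit_prob r xs s : R :=
  if r < rnorm s then 1
  else if xs is x :: xs' then (hit_prob r xs' (s + x) + hit_prob r xs' (s - x)) / 2 else 0.

(** The Levy maximal inequality: at the first exit, reflecting the remaining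
signs leaves at least one of the two end points outside the ball. *)
Lemma levy r xs s : hit_prob r xs s <= 2 * signavg xs (exceeds r) s.
Proof.
have base xs' s' : r < rnorm s' -> 1 <= 2 * signavg xs' (exceeds r) s'.
  move=> rs; rewrite mulrDl mul1r.
  have e : signavg xs' (fun v => exceeds r (s' + s' - v)) s' =
           signavg xs' (exceeds r) s' by rewrite signavg_reflect addrK.
  rewrite -{2}e -signavgD -[leLHS](signavg_cst xs' _ s').
  apply: le_signavg => v.
  have := exceeds_double r s' (v - s').
  rewrite subrK; have -> : v - s' - s' = - (s' + s' - v) by rewrite opprB opprD addrA.
  by rewrite exceedsN /exceeds rs.
elim: xs s => /= [|x xs IH] s; case: ltP => rs.
- exact: (base [::]).
- by rewrite mulr_ge0 // exceeds_ge0.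
- exact: (base (x :: xs)).
- by rewrite mulrA ler_wpM2r // mulrDr lerD.
Qed.

(** To end outside the ball of radius 2 r, a walk must first leave the ball of
radius r, and then the steps from the exit step on must contribute more than r.
By symmetry the size of this contribution does not depend on the sign of the
exit step, hence not on the past. *)
Lemma stopped_tail r (b : R) xs s :
  (forall ys zs, xs = ys ++ zs -> tail_prob zs r <= b) ->
  rnorm s <= r -> signavg xs (exceeds (r + r)) s <= b * hit_prob r xs s.
Proof.
elim: xs s => /= [|x xs IH] s bP rs; rewrite ltNge rs /=.
  rewrite mulr0 /exceeds ltNge (le_trans rs)//.
  by rewrite lerDl (le_trans _ rs) // rnorm_ge0.
have b0 : 0 <= b by apply: le_trans (bP [::] _ erefl); exact: tail_ge0.
have bP' : forall ys zs, xs = ys ++ zs -> tail_prob zs r <= b.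
  by move=> ys zs e; apply: (bP (x :: ys)); rewrite e.
have sgnx y : y = x \/ y = - x -> signavg xs (exceeds r) y = tail_prob (x :: xs) r.
  have e : signavg xs (exceeds r) (- x) = signavg xs (exceeds r) x.
    rewrite -[- x]sub0r -signavg_reflect; apply: eq_signavg => v.
    by rewrite sub0r exceedsN.
  rewrite /tail_prob /= !add0r e => -[] ->; rewrite ?e; lra.
have step y : y = x \/ y = - x ->
    signavg xs (exceeds (r + r)) (s + y) <= b * hit_prob r xs (s + y).
  move=> yx; have [ry|] := ltP r (rnorm (s + y)); last exact: IH.
  have -> : hit_prob r xs (s + y) = 1 by case: (xs) => /=; rewrite ry.
  rewrite mulr1 (le_trans _ (bP [::] _ erefl))// -(sgnx _ yx) -signavg_shift.
  apply: le_signavg => v; apply: (le_trans (exceedsD _ _ _)).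
  by rewrite {1}/exceeds ltNge rs add0r.
by rewrite mulrA ler_wpM2r // mulrDr lerD //; apply: step; [left|right].
Qed.

(** Both factors of the bound in stopped_tail are at most twice the tail itself,
by tail_suffix and levy.  Squaring is what makes the tails decay faster than
any power. *)
Lemma kahane_tail xs r : 0 <= r -> tail_prob xs (r + r) <= 4 * tail_prob xs r ^+ 2.
Proof.
move=> r0; have -> : 4 * tail_prob xs r ^+ 2 = (2 * tail_prob xs r) * (2 * tail_prob xs r).
  by rewrite expr2; ring.
apply: (@le_trans _ _ (2 * tail_prob xs r * hit_prob r xs 0)).
  apply: stopped_tail; last by rewrite rnorm0.
  by move=> ys zs ->; exact: tail_suffix.
by rewrite ler_wpM2l ?mulr_ge0 ?tail_ge0// levy.
Qed.

(** Iteration of kahane_tail from 4 t_0 <= 1/4, where t_(m+1) <= 4 t_m^2. *)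
Lemma tail_pow2 xs r n : 0 <= r -> tail_prob xs r <= 16^-1 ->
  tail_prob xs (2 ^+ n * r) <= 4^-1 ^+ (2 ^ n).+1.
Proof.
move=> r0 tr; elim: n => [|n IH].
  by rewrite expr0 mul1r expn0 (le_trans tr)//; lra.
rewrite exprS -mulrA mulrDl mul1r (le_trans (kahane_tail _ _))//.
  by rewrite mulr_ge0// exprn_ge0.
have : tail_prob xs (2 ^+ n * r) ^+ 2 <= (4^-1 ^+ (2 ^ n).+1) ^+ 2.
  by rewrite lerXn2r // ?nnegrE ?tail_ge0 ?exprn_ge0.
have -> : (4^-1 : R) ^+ (2 ^ n.+1).+1 = 4 * (4^-1 ^+ (2 ^ n).+1) ^+ 2.
  rewrite -exprM; have -> : ((2 ^ n).+1 * 2 = (2 ^ n.+1).+2)%N by rewrite expnS; lia.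
  by rewrite [in RHS]exprS mulrA mulfV ?mul1r.
by move=> h; rewrite ler_wpM2l.
Qed.

Lemma layer_cake (D m : nat) (t : R) : 0 <= t -> t <= 2 ^+ m ->
  t ^+ D <= 1 + \sum_(i < m) 2 ^+ (i.+1 * D) * (2 ^+ i < t)%R%:R.
Proof.
move=> t0; elim: m => [|m IH] tm.
  by rewrite big_ord0 addr0 exprn_ile1.
rewrite big_ord_recr /= addrA; have [/IH h|tm'] := leP t (2 ^+ m).
  by rewrite mulr0 addr0.
rewrite mulr1 ler_wpDl//.
  by rewrite addr_ge0// sumr_ge0// => i _; rewrite mulr_ge0 ?exprn_ge0.
by rewrite exprM lerXn2r // ?nnegrE ?exprn_ge0.
Qed.

(** The elementary growth comparison that makes the layer-cake sum converge. *)
Lemma sqr_le_pow2 n : (n ^ 2 <= 2 ^ n.+1)%N.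
Proof.
elim: n => // -[|[|[|n]]] // IH.
rewrite expnS (leq_trans _ (leq_mul (leqnn 2) IH))// -!mulnn.
by rewrite !mulSn !mulnS; lia.
Qed.

End kahane.

(** * Moments of sign sums *)

Section moments.
Context {R : realType} {k : scalar_kind} {V : normedModType (scalar_field R k)}.
Implicit Types (xs : seq V) (r : R) (s : V).

(** Only the values of F and G on the finite, hence bounded, set of possible sums
matter. *)
Lemma le_signavg_ball xs (F G : V -> R) s :
  (forall v, rnorm v <= rnorm s + \sum_(x <- xs) rnorm x -> F v <= G v) ->
  signavg xs F s <= signavg xs G s.
Proof.
elim: xs s => /= [|x xs IH] s FG; first by apply: FG; rewrite big_nil addr0.
rewrite ler_wpM2r// lerD//; apply: IH => v vs; apply: FG;
  rewrite (le_trans vs)// big_cons addrA lerD2r (le_trans (ler_rnormD _ _))//.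
by rewrite rnormN.
Qed.

Lemma sum_half_pow (m : nat) : \sum_(i < m) (2^-1 : R) ^+ i.+1 <= 1.
Proof.
suff -> : \sum_(i < m) (2^-1 : R) ^+ i.+1 = 1 - 2^-1 ^+ m.
  by rewrite gerBl exprn_ge0.
elim: m => [|m IH]; first by rewrite big_ord0 expr0 subrr.
by rewrite big_ord_recr /= IH exprS; lra.
Qed.

(** 2 (i+1)(D+1) <= (i+1)^2 + (D+1)^2 and (i+1)^2 <= 2^(i+2) absorb the polynomial
factor; the bound is geometric in i. *)
Lemma pow_tail_le (D i : nat) :
  (2 : R) ^+ (i.+1 * D) * 4^-1 ^+ (2 ^ i).+1 <= 2 ^+ (D.+1 ^ 2) * 2^-1 ^+ i.+1.
Proof.
have -> : (4 : R)^-1 = 2^-1 ^+ 2 by rewrite expr2; lra.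
rewrite -exprM !exprVn ler_pdivrMr ?exprn_gt0// mulrAC ler_pdivlMr ?exprn_gt0//.
rewrite -!exprD ler_eXn2l ?ltr1n//.
have := sqr_le_pow2 i.+1; rewrite !expnS !expn0 => h.
have := (nat_Cauchy i.+1 D.+1).1; rewrite -!mulnn => h'.
by lia.
Qed.

(** Depends on the exponent only, not on the vectors or their number. *)
Definition moment_bound (D : nat) : R := 1 + 2 ^+ (D.+1 ^ 2).

Lemma moment_bound_ge0 D : 0 <= moment_bound D.
Proof. by rewrite addr_ge0// exprn_ge0. Qed.

(** The layer-cake formula over the radii 2^i r, with the doubly exponential decay
of tail_pow2. *)
Lemma kahane_moment xs r (D : nat) : 0 < r -> tail_prob xs r <= 16^-1 ->
  signavg xs (fun v => rnorm v ^+ D) 0 <= r ^+ D * moment_bound D.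
Proof.
move=> r0 tr; pose B := \sum_(x <- xs) rnorm x.
(* a radius 2^m r beyond all possible values of the sum *)
have [m Bm] : exists m, B / r <= 2 ^+ m.
  exists (Num.bound (B / r)).
  have B0 : 0 <= B / r.
    by rewrite divr_ge0 ?(ltW r0)// sumr_ge0// => i _; exact: rnorm_ge0.
  rewrite (le_trans (ltW (archi_boundP B0)))// -natrX ler_nat.
  exact/ltnW/ltn_expl.
apply: (@le_trans _ _ (signavg xs (fun v => r ^+ D *
    (1 + \sum_(i < m) 2 ^+ (i.+1 * D) * exceeds (2 ^+ i * r) v)) 0)).
  apply: le_signavg_ball => v; rewrite rnorm0 add0r -/B => vB.
  have := @layer_cake R D m (rnorm v / r).
  rewrite divr_ge0 ?rnorm_ge0 ?(ltW r0)// (le_trans _ Bm); last first.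
    by rewrite ler_pM2r ?invr_gt0.
  move=> /(_ erefl erefl); rewrite expr_div_n ler_pdivrMr ?exprn_gt0// mulrC.
  move=> /le_trans; apply; rewrite ler_pM2l ?exprn_gt0// lerD2l.
  by apply: ler_sum => i _; rewrite /exceeds ltr_pdivlMr.
rewrite signavgZ ler_pM2l ?exprn_gt0// signavgD signavg_cst lerD2l signavg_sum.
apply: (@le_trans _ _ (2 ^+ (D.+1 ^ 2) * \sum_(i < m) 2^-1 ^+ i.+1)); last first.
  by rewrite ler_piMr ?exprn_ge0// sum_half_pow.
rewrite mulr_sumr; apply: ler_sum => i _; rewrite signavgZ.
apply: le_trans (pow_tail_le D i).
by rewrite ler_wpM2l ?exprn_ge0// tail_pow2// ltW.
Qed.

Lemma powR_le_expn (a q : R) (D : nat) : 0 <= a -> 0 <= q -> q <= D%:R ->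
  a `^ q <= 1 + a ^+ D.
Proof.
move=> a0 q0 qD; have [a1|a1] := leP a 1.
  rewrite ler_wpDr ?exprn_ge0//.
  have <- : 1 `^ q = 1 :> R by rewrite powR1.
  by rewrite ge0_ler_powR// ?nnegrE.
rewrite ler_wpDl// -powR_mulrn//.
by rewrite ler_powR// ltW.
Qed.

Lemma kahane_powR xs r (q : R) (D : nat) : 0 < r -> tail_prob xs r <= 16^-1 ->
  0 <= q -> q <= D%:R ->
  signavg xs (fun v => rnorm v `^ q) 0 <= 1 + r ^+ D * moment_bound D.
Proof.
move=> r0 tr q0 qD; rewrite -{1}(signavg_cst xs (1 : R) 0).
apply: le_trans (lerD (lexx _) (kahane_moment D r0 tr)).
rewrite -signavgD; apply: le_signavg => v.
by apply: powR_le_expn; rewrite ?rnorm_ge0.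
Qed.

End moments.

Section khinchin.
Context {R : realType} {k : scalar_kind}.
Local Notation K := (scalar_field R k).

(** Over both fields the modulus is a Euclidean norm on the real coordinates. *)
Lemma parallelogram (a b : K^o) :
  rnorm (a + b) ^+ 2 + rnorm (a - b) ^+ 2 = 2 * (rnorm a ^+ 2 + rnorm b ^+ 2).
Proof.
rewrite /rnorm; case: k a b => /= a b; first by rewrite !real_normK ?num_real//; ring.
case: a => a1 a2; case: b => b1 b2; rewrite /= !sqr_sqrtr ?addr_ge0 ?sqr_ge0//.
ring.
Qed.

Lemma signavg_sqr (xs : seq K^o) s :
  signavg xs (fun v => rnorm v ^+ 2) s =
  rnorm s ^+ 2 + \sum_(x <- xs) rnorm x ^+ 2.
Proof.
elim: xs s => /= [|x xs IH] s; first by rewrite big_nil addr0.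
by rewrite !IH big_cons; have := parallelogram s x; lra.
Qed.

(** The second moment is explicit, so the Chebyshev inequality at radius 4 gives a
tail of at most 1/16, and all the other moments follow from kahane_powR. *)
Lemma khinchin (xs : seq K^o) (q : R) (D : nat) :
  \sum_(x <- xs) rnorm x ^+ 2 <= 1 -> 0 <= q -> q <= D%:R ->
  signavg xs (fun v => rnorm v `^ q) 0 <= 1 + 4 ^+ D * moment_bound D.
Proof.
move=> xs1; apply: kahane_powR => //.
have : signavg xs (fun v : K^o => 16 * exceeds 4 v) 0 <= 1.
  apply: le_trans xs1; have := signavg_sqr xs 0.
  rewrite rnorm0 expr0n add0r => <-; apply: le_signavg => v.
  rewrite /exceeds; case: ltP => v4; last by rewrite mulr0 exprn_ge0 ?rnorm_ge0.
  by rewrite mulr1 expr2 (le_trans _ (ler_pM _ _ (ltW v4) (ltW v4)))//; lra.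
by rewrite signavgZ -/(tail_prob xs 4) => h; lra.
Qed.

End khinchin.

Section sign_vectors.
Context {R : realType} {K : nzRingType} {V : lmodType K}.

(** Induction on the number of random signs involved, redrawing the last one. *)
Lemma sum_signs_prefix (N m : nat) (x : nat -> V) (F : V -> R) : (m <= N)%N ->
  \sum_(e : {ffun 'I_N -> bool}) F (\sum_(j < N | (j < m)%N) (-1) ^+ e j *: x j) =
  2 ^+ N * signavg (mkseq x m) F 0.
Proof.
elim: m F => [|m IH] F mN.
  under eq_bigr => e _ do rewrite big_pred0//.
  by rewrite sumr_const card_ffun card_bool card_ord -natrX mulr_natl.
pose i := Ordinal mN.
have := sum_resample i (fun e : {ffun 'I_N -> bool} =>
  F (\sum_(j < N | (j < m.+1)%N) (-1) ^+ e j *: x j)).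
rewrite card_bool.
under eq_bigr => e _.
  have split s : \sum_(j < N | (j < m.+1)%N) (-1) ^+ resample e i s j *: x j =
      (\sum_(j < N | (j < m)%N) (-1) ^+ e j *: x j) + (-1) ^+ s *: x m.
    rewrite (bigD1 i)//= addrC ffunE eqxx; congr (_ + _).
    apply: eq_big => [j|j /andP[_ ji]]; last by rewrite ffunE (negbTE ji).
    by rewrite ltnS -val_eqE /=; case: ltngtP.
  rewrite big_bool /= !split expr1 scaleN1r expr0 scale1r.
  over.
move=> h.
have := IH (signavg [:: x m] F) (ltnW mN).
rewrite mkseqS -cats1 signavg_cat => <- /=; rewrite -mulr_suml.
rewrite (eq_bigr _ (fun e _ => addrC _ _)).
move: h => /= ->; rewrite mulr2n; lra.
Qed.

Lemma sum_signs (N : nat) (x : nat -> V) (F : V -> R) :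
  \sum_(e : {ffun 'I_N -> bool}) F (\sum_(j < N) (-1) ^+ e j *: x j) =
  2 ^+ N * signavg (mkseq x N) F 0.
Proof.
rewrite -sum_signs_prefix//; apply: eq_bigr => e _; congr F.
by apply: eq_bigl => j; rewrite ltn_ord.
Qed.

End sign_vectors.

(** * Rademacher functions as random signs *)

Section dyadic_intervals.
Context {R : realType}.
Implicit Types (b : nat -> bool) (t : R).

Definition dyadic (N : nat) b : R := \sum_(j < N) (b j)%:R / 2 ^+ j.+1.

Definition dyadic_itv (N : nat) b : set R :=
  `]dyadic N b, dyadic N b + 2^-1 ^+ N[%classic.

Lemma dyadicS N b : dyadic N.+1 b = (b 0%N)%:R / 2 + dyadic N (b \o S) / 2.
Proof.
rewrite /dyadic big_ord_recl expr1 mulr_suml; congr (_ + _).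
apply: eq_bigr => j _; rewrite /= /bump add1n [in LHS]exprS invfM.
by rewrite mulrCA mulrC.
Qed.

Lemma dyadic_ge0 N b : 0 <= dyadic N b.
Proof. by apply: sumr_ge0 => j _; rewrite divr_ge0// exprn_ge0. Qed.

Lemma dyadic_le1 N b : dyadic N b + 2^-1 ^+ N <= 1.
Proof.
elim: N b => [|N IH] b; first by rewrite /dyadic big_ord0 add0r expr0.
rewrite dyadicS exprS; have := IH (b \o S).
by case: (b 0%N) => /=; lra.
Qed.

Lemma sinD2npi (x : R) n : sin (x + pi * (2 * n)%:R) = sin x.
Proof.
by rewrite -(periodicn (@sinD2pi R) n x) -mulrnA mulr_natr.
Qed.

Lemma rademacher_half (c : bool) t : c%:R / 2 < t < c%:R / 2 + 2^-1 ->
  rademacher 0 t = (-1) ^+ c.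
Proof.
have pi0 := pi_gt0 R.
rewrite /rademacher expr1; case: c => /= /andP[t0 t1].
  rewrite ltr0_sgz//; have -> : 2 * pi * t = (2 * t - 1) * pi + pi by ring.
  rewrite sinDpi oppr_lt0 sin_gt0_pi//; apply/andP; split.
    by rewrite mulr_gt0//; lra.
  by rewrite gtr_pMl//; lra.
rewrite gtr0_sgz// sin_gt0_pi//; apply/andP; split.
  by rewrite mulr_gt0//; lra.
by rewrite mulrAC gtr_pMl//; lra.
Qed.

(** The Rademacher functions are self-similar under the doubling map, which lets
rademacher_dyadic go by induction on the number of digits. *)
Lemma rademacher_shift j (c : bool) t :
  rademacher j (2 * t - c%:R) = rademacher j.+1 t.
Proof.
rewrite /rademacher; congr sgz; rewrite -(sinD2npi _ (c * 2 ^ j)); congr sin.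
by rewrite !natrM natrX !exprS; ring.
Qed.

Lemma rademacher_dyadic N b t j : dyadic_itv N b t -> (j < N)%N ->
  rademacher j t = (-1) ^+ b j.
Proof.
rewrite /dyadic_itv /= in_itv/=.
elim: N b t j => // N IH b t [|j] tb jN; last first.
  rewrite -(rademacher_shift j (b 0%N)); apply: (IH (b \o S)) => //.
  by move: tb; rewrite dyadicS exprS => /andP[t0 t1]; apply/andP; split; lra.
apply: rademacher_half; move: tb; rewrite dyadicS exprS => /andP[t0 t1].
have := dyadic_ge0 N (b \o S); have := dyadic_le1 N (b \o S).
by move=> d1 d0; apply/andP; split; lra.
Qed.

Lemma dyadic_itv_sub01 N b : dyadic_itv N b `<=` `[0, 1].
Proof.
move=> t; rewrite /dyadic_itv /= !in_itv/= => /andP[t0 t1].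
by rewrite (le_trans (dyadic_ge0 N b) (ltW t0)) (le_trans (ltW t1) (dyadic_le1 N b)).
Qed.

Lemma measure_dyadic_itv N b :
  lebesgue_measure (dyadic_itv N b) = (2^-1 ^+ N)%:E.
Proof.
rewrite lebesgue_measure_itv/= lte_fin ltrDl exprn_gt0//.
by rewrite -EFinD addrAC subrr add0r.
Qed.

(** Signs are indexed by ordinals, binary digits by nat. *)
Definition extend_signs N (e : {ffun 'I_N -> bool}) (j : nat) : bool :=
  oapp e false (insub j).

Lemma extend_signsE N (e : {ffun 'I_N -> bool}) (j : 'I_N) : extend_signs e j = e j.
Proof. by rewrite /extend_signs valK. Qed.

Lemma signr_bool_inj (a b : bool) : (-1) ^+ a = (-1) ^+ b :> int -> a = b.
Proof. by case: a b => -[]. Qed.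

Lemma trivIset_dyadic_itv N (D : set {ffun 'I_N -> bool}) :
  trivIset D (fun e => dyadic_itv N (extend_signs e)).
Proof.
apply/trivIsetP => e e' _ _; apply: contra_neqP => /eqP/set0P[t [te te']].
apply/ffunP => j; apply: signr_bool_inj.
by rewrite -!extend_signsE -(rademacher_dyadic te)// -(rademacher_dyadic te').
Qed.

Lemma measure_dyadic_union N (P : pred {ffun 'I_N -> bool}) :
  lebesgue_measure (\bigcup_(e in [set` P]) dyadic_itv N (extend_signs e)) =
  (#|P|%:R * 2^-1 ^+ N)%:E.
Proof.
have PE : [set` P] = [set` enum P] by apply/seteqP; split=> e /=; rewrite mem_enum.
rewrite PE measure_fin_bigcup//=.
- rewrite -fsbig_seq ?enum_uniq// (eq_bigr _ (fun e _ => measure_dyadic_itv N _)).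
  by rewrite sumEFin big_enum/= sumr_const mulr_natl.
- exact: trivIset_dyadic_itv.
- by move=> e _; exact: measurable_itv.
Qed.

End dyadic_intervals.

Section rad_tail.
Context {R : realType} {k : scalar_kind} {V : normedModType (scalar_field R k)}.

Lemma cvg_rnorm_bounded (u : nat -> V) :
  cvgn u -> exists M : nat, forall n, rnorm (u n) <= M%:R.
Proof.
move=> /cvg_seq_bounded/pinfty_ex_gt0[M M0 uM].
exists (Num.bound (scalar_re M)) => n.
have : rnorm (u n) <= scalar_re M.
  by rewrite -(@ler_scalar_of R k) scalar_of_rnorm scalar_reK ?(ltW M0)// uM.
move=> /le_trans; apply; apply/ltW/archi_boundP.
by rewrite -(@ler_scalar_of R k) scalar_of0 scalar_reK ltW.
Qed.

Definition large_signs (x : nat -> V) (N M : nat) : pred {ffun 'I_N -> bool} :=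
  fun e => M%:R < rnorm (\sum_(j < N) (-1) ^+ e j *: x j).

Arguments large_signs x N M _ : clear implicits.

Lemma tail_card (x : nat -> V) (N M : nat) :
  tail_prob (mkseq x N) M%:R = #|large_signs x N M|%:R * 2^-1 ^+ N.
Proof.
have := sum_signs N x (exceeds M%:R).
rewrite -/(tail_prob (mkseq x N) M%:R) => sumE; apply: (@mulfI _ (2 ^+ N)).
  by rewrite expf_neq0// pnatr_eq0.
rewrite -sumE exprVn mulrCA divff ?expf_neq0 ?pnatr_eq0// mulr1.
by rewrite -sum1_card natr_sum [RHS]big_mkcond/=; apply: eq_bigr => e _;
  rewrite /exceeds unfold_in /large_signs; case: ifP.
Qed.

(** Almost sure convergence implies almost sure boundedness.  The event U M that
some partial sum exceeds M is represented, up to the dyadic points, by a union of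
open dyadic intervals and is therefore measurable; the U M decrease to a
negligible set, and continuity from above of the Lebesgue measure makes one of
them small. *)
Lemma rad_tail (x : nat -> V) : Defs.rad x ->
  exists M : nat, forall N, tail_prob (mkseq x N) M%:R <= 16^-1.
Proof.
move=> radx.
pose U (M : nat) : set R := \bigcup_N
  \bigcup_(e in [set` large_signs x N M]) dyadic_itv N (extend_signs e).
have mUN N M : measurable
    (\bigcup_(e in [set` large_signs x N M]) dyadic_itv N (extend_signs e) : set R).
  apply: fin_bigcup_measurable => [|e _]; last exact: measurable_itv.
  exact: finite_finset.
have mU M : measurable (U M) by apply: bigcupT_measurable => N; exact: mUN.
have U01 M : U M `<=` `[0, 1]%classic.
  by move=> t [N _ [e _ te]]; exact: dyadic_itv_sub01 te.
have U0 : lebesgue_measure (\bigcap_M U M) = 0%E.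
  apply: measure_negligible; first exact: bigcapT_measurable.
  apply: negligibleS radx => t Ut /=; apply/not_implyP; split.
    by have /= := U01 0%N _ (Ut 0%N I).
  move=> cv; have [M tM] := cvg_rnorm_bounded cv.
  have [N _ [e /= eM te]] := Ut M I.
  have := tM N; rewrite leNgt => /negP; apply.
  move: eM; rewrite /large_signs; congr (_ < rnorm _).
  rewrite /series/= big_mkord; apply: eq_bigr => j _.
  rewrite (rademacher_dyadic te)// extend_signsE.
  by rewrite rmorphXn/= rmorphN1.
have cU : (lebesgue_measure \o U) M @[M --> \oo] --> 0%E.
  rewrite -U0; apply: nonincreasing_cvg_mu => //.
  - apply: (@le_lt_trans _ _ (lebesgue_measure (`[0, 1]%classic : set R))).
      by apply: le_measure; rewrite ?inE; [exact: mU|exact: measurable_itv|exact: U01].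
    by rewrite lebesgue_measure_itv/= lte_fin ltr01 -EFinB ltry.
  - exact: bigcapT_measurable.
  - move=> m n mn; apply/subsetPset => t [N _ [e /= eM te]].
    exists N => //; exists e => //=; apply: le_lt_trans eM.
    by rewrite ler_nat.
have /fine_cvgP[finU /cvgr_le cvU] := cU.
have [M [/= fM UM]] : exists M, (lebesgue_measure (U M) \is a fin_num) /\
    fine (lebesgue_measure (U M)) <= 16^-1.
  have e16 : (0 : R) < 16^-1 by rewrite invr_gt0 ltr0n.
  have [M [fM UM]] := filter_ex (filterI finU (cvU _ e16)); by exists M.
exists M => N; rewrite tail_card -lee_fin.
rewrite -measure_dyadic_union -(fineK fM) in UM *.
apply: (@le_trans _ _ (lebesgue_measure (U M))); last by rewrite -(fineK fM) lee_fin.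
by apply: le_measure; rewrite ?inE; [exact: mUN|exact: mU|move=> t tN; exists N].
Qed.

End rad_tail.

(** * Series and finite families *)

Section series.
Context {R : realType}.

Lemma nneseries_leP (u : nat -> R) (C : R) : (forall j, 0 <= u j) ->
  (\sum_(0 <= j <oo) (u j)%:E <= C%:E)%E <-> forall N, \sum_(j < N) u j <= C.
Proof.
move=> u0; split => [uC N|uC].
  rewrite -lee_fin (le_trans _ uC)// -sumEFin -(big_mkord predT (fun j => (u j)%:E)).
  by apply: nneseries_lim_ge => j _ _; rewrite lee_fin.
apply: lime_le; first by apply: is_cvg_nneseries => j _ _; rewrite lee_fin.
by apply: nearW => N; rewrite big_mkord sumEFin lee_fin.
Qed.

Lemma nneseries_ltyP (u : nat -> R) : (forall j, 0 <= u j) ->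
  (\sum_(0 <= j <oo) (u j)%:E < +oo)%E <->
  exists C, forall N, \sum_(j < N) u j <= C.
Proof.
move=> u0; split => [uy|[C uC]]; last first.
  by apply: (@le_lt_trans _ _ C%:E); [exact/nneseries_leP|rewrite ltry].
have s0 : (0 <= \sum_(0 <= j <oo) (u j)%:E)%E.
  by apply: nneseries_ge0 => j _ _; rewrite lee_fin.
exists (fine (\sum_(0 <= j <oo) (u j)%:E)); apply/nneseries_leP => //.
by rewrite fineK// ge0_fin_numE.
Qed.

Lemma nneseries_pairs (e : nat -> nat * nat) (g : nat -> nat -> \bar R) :
  bijective e -> (forall i j, 0 <= g i j)%E ->
  (\sum_(0 <= l <oo) g (e l).1 (e l).2 =
   \sum_(0 <= i <oo) \sum_(0 <= j <oo) g i j)%E.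
Proof.
move=> be g0; rewrite nneseries_esumT//.
rewrite -(@reindex_esum R _ _ setT setT e (fun u => g u.1 u.2)); last first.
  by rewrite setTT_bijective.
rewrite nneseries_esumT => [|i]; last by apply: nneseries_ge0 => *.
rewrite (@eq_esum _ _ _ _ (fun i => \esum_(j in setT) g i j)%E) => [|i _]; last first.
  by rewrite nneseries_esumT.
by rewrite esum_esum//; congr (esum _ _); apply/seteqP; split.
Qed.

Lemma nat_pairs : exists e : nat -> nat * nat, bijective e.
Proof.
have /card_esym/ppcard_eqP[f] := card_nat2.
by exists f; rewrite -setTT_bijective; exact: bij.
Qed.

(** An enumeration of a finite type by an initial segment of nat, through which
finite families become sequences that vanish from some index on. *)
Definition listing (T : finType) (j : nat) : option T :=
  omap enum_val (insub j : option 'I_#|T|).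

Lemma sum_listing (T : finType) (u : T -> R) :
  \sum_(j < #|T|) oapp u 0 (listing T j) = \sum_t u t.
Proof.
rewrite (reindex (fun i : 'I_#|T| => enum_val i)) /=; last first.
  by exists enum_rank => i _; rewrite ?enum_valK ?enum_rankK.
by apply: eq_bigr => j _; rewrite /listing valK.
Qed.

Lemma le_sum_listing (T : finType) (u : T -> R) N : (forall t, 0 <= u t) ->
  \sum_(j < N) oapp u 0 (listing T j) <= \sum_t u t.
Proof.
move=> u0; rewrite -sum_listing.
apply: (@le_trans _ _ (\sum_(j < #|T| + N) oapp u 0 (listing T j))).
  rewrite addnC big_split_ord/= lerDl sumr_ge0// => j _.
  by case: listing => //=.
rewrite big_split_ord/= gerDl big1// => j _.
by rewrite /listing insubF// ltnNge leq_addr.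
Qed.

End series.

(** * Functionals, weak norms and Cohen norms *)

Section duality.
Context {R : realType} {k : scalar_kind}.
Local Notation K := (scalar_field R k).
Implicit Types V W : normedModType K.

Lemma linear_zero (U W : lmodType K) (f : U -> W) : linear f -> f 0 = 0.
Proof.
by move=> lf; have := lf (-1) 0 0; rewrite scaler0 addr0 scaleN1r addNr.
Qed.

Lemma linear_sum_scale (U W : lmodType K) (f : U -> W) (I : finType)
    (P : pred I) (c : I -> K) (u : I -> U) : linear f ->
  f (\sum_(i | P i) c i *: u i) = \sum_(i | P i) c i *: f (u i).
Proof.
move=> lf; elim/big_rec2: _ => [|i w v _ <-]; first exact: linear_zero.
by rewrite lf.
Qed.

Lemma linear_scale (U W : lmodType K) (f : U -> W) c u : linear f ->
  f (c *: u) = c *: f u.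
Proof.
by move=> lf; have := lf c u 0; rewrite (linear_zero lf) !addr0.
Qed.

Lemma rnorm_sum V (I : Type) (r : seq I) (P : pred I) (x : I -> V) :
  rnorm (\sum_(i <- r | P i) x i) <= \sum_(i <- r | P i) rnorm (x i).
Proof.
elim/big_rec2: _ => [|i a v _ h]; first by rewrite rnorm0.
by rewrite (le_trans (ler_rnormD _ _))// lerD2l.
Qed.

Lemma rnorm_eq0 V (x : V) : (rnorm x == 0) = (x == 0).
Proof.
rewrite -(normr_eq0 x) -scalar_of_rnorm; apply/eqP/eqP => [->|].
  by rewrite scalar_of0.
by move=> e; rewrite -(@scalar_ofK R k (rnorm x)) e -(@scalar_of0 R k) scalar_ofK.
Qed.

Lemma rnormZ_real V (a : R) (x : V) : 0 <= a ->
  rnorm (scalar_of k a *: x) = a * rnorm x.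
Proof. by move=> a0; rewrite rnormZ rnorm_scalar_of. Qed.

Lemma bounded_of_ball V W (f : V -> W) (M : R) : linear f ->
  (forall x, rnorm x <= 1 -> rnorm (f x) <= M) ->
  forall x, rnorm (f x) <= M * rnorm x.
Proof.
move=> lf fM x; have [->|x0] := eqVneq x 0.
  by rewrite (linear_zero lf) !rnorm0 mulr0.
have nx : 0 < rnorm x by rewrite lt_neqAle eq_sym rnorm_eq0 x0 rnorm_ge0.
have := fM (scalar_of k (rnorm x)^-1 *: x).
rewrite linear_scale// !rnormZ_real ?invr_ge0 ?rnorm_ge0//.
by rewrite mulVf ?gt_eqF// => /(_ (lexx _)); rewrite ler_pdivrMl// mulrC.
Qed.

Lemma dual_ubound V (f : dual_space V) x : rnorm (f x) <= rnorm f * rnorm x.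
Proof.
apply: bounded_of_ball x; first by have [] := dualP f.
move=> x /(dual_norm_ub f).
by rewrite -[dual_norm f]/(`|f|) -scalar_of_rnorm ler_scalar_of.
Qed.

Lemma dual_norm_le_rnorm V (f : dual_space V) (M : R) :
  (forall x, rnorm x <= 1 -> rnorm (f x) <= M) -> rnorm f <= M.
Proof.
by move=> /dual_norm_le; rewrite -[dual_norm f]/(`|f|) -scalar_of_rnorm ler_scalar_of.
Qed.

Lemma continuous_of_bounded V W (f : V -> W) (M : R) : linear f ->
  (forall x, rnorm (f x) <= M * rnorm x) -> continuous f.
Proof.
move=> lf fM.
pose lin := GRing.isLinear.Build K V W *:%R f lf.
pose g : {linear V -> W} := HB.pack f lin.
have M0 : 0 <= `|M| by [].
apply: (@bounded_linear_continuous _ _ _ g).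
apply/linear_boundedP; near=> c => x.
have cM : scalar_of k `|M| <= c.
  near: c; apply: nbhs_pinfty_ge.
  by rewrite ger0_real// -(@scalar_of0 R k) ler_scalar_of.
apply: (@le_trans _ _ (scalar_of k `|M| * `|x|)); last by rewrite ler_wpM2r.
rewrite -!scalar_of_rnorm -scalar_ofM ler_scalar_of (le_trans (fM x))//.
by rewrite ler_wpM2r ?rnorm_ge0// ler_norm.
Unshelve. all: by end_near. Qed.

Lemma exists_dual V (f : V -> K^o) (M : R) : linear f ->
  (forall x, rnorm (f x) <= M * rnorm x) -> 0 <= M ->
  exists g : dual_space V, (forall x, g x = f x) /\ rnorm g <= M.
Proof.
move=> lf fM M0.
have fP : f \in @dual_pred R k V by apply/asboolP; split=> //; exact: continuous_of_bounded fM.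
exists (Dual fP); split=> //; apply: dual_norm_le_rnorm => x x1 /=.
by rewrite (le_trans (fM x))// ler_piMr.
Qed.

Lemma continuous_linear_bound V W (f : V -> W) : linear f -> continuous f ->
  exists M : R, 0 <= M /\ forall x, rnorm (f x) <= M * rnorm x.
Proof.
move=> lf cf.
pose lin := GRing.isLinear.Build K V W *:%R f lf.
pose g : {linear V -> W} := HB.pack f lin.
have /linear_boundedP/pinfty_ex_gt0[M M0 fM] : bounded_near g (nbhs 0).
  exact/linear_bounded_continuous.
exists (scalar_re M); split.
  by rewrite -(@ler_scalar_of R k) scalar_of0 scalar_reK ltW.
move=> x; rewrite -(@ler_scalar_of R k) scalar_ofM !scalar_of_rnorm.
by rewrite scalar_reK ?(ltW M0).
Qed.

Lemma exists_phase (z : K^o) : exists c : K, rnorm (c : K^o) = 1 /\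
  c * z = scalar_of k (rnorm z).
Proof.
have [->|z0] := eqVneq z 0.
  exists 1; rewrite mulr0 rnorm0 scalar_of0; split=> //.
  by rewrite -(@scalar_of1 R k) rnorm_scalar_of.
exists (`|z| / z); split; last by rewrite divfK// scalar_of_rnorm.
rewrite /rnorm [X in scalar_re X]normf_div normr_id divff ?normr_eq0//.
by rewrite -(@scalar_of1 R k) scalar_ofK.
Qed.

(** The condition weak_norm q x <= 1 unfolded to finite sums, see weak_norm_le1. *)
Definition weakly_unit V (q : R) (x : nat -> V) :=
  forall f : dual_space V, rnorm f <= 1 ->
    forall N, \sum_(j < N) rnorm (f (x j)) `^ q <= 1.

Lemma weak_norm_le1 V (q : R) (x : nat -> V) : 0 < q ->
  (weak_norm q x <= 1)%E <-> weakly_unit q x.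
Proof.
move=> q0; have qV0 : 0 < q^-1 by rewrite invr_gt0.
have h0 (f : dual_space V) j : 0 <= rnorm (f (x j)) `^ q by exact: powR_ge0.
split => [x1 f f1|x1].
  apply/(nneseries_leP 1 (h0 f)).
  have : ((\sum_(0 <= j <oo) (rnorm (f (x j)) `^ q)%:E) `^ q^-1 <= 1)%E.
    by apply: le_trans x1; apply: ereal_sup_ubound; exists f.
  move=> h; have := gt0_ler_poweR (ltW q0) _ _ h.
  rewrite -poweRrM mulVf ?gt_eqF// poweRe1 ?poweR1r; last first.
    by apply: nneseries_ge0 => j _ _; rewrite lee_fin.
  by apply; rewrite in_itv/= ?poweR_ge0 ?leey// lee01.
apply: ge_ereal_sup => _ [f /= f1 <-].
rewrite -(poweR1r q^-1); apply: gt0_ler_poweR; first exact: ltW.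
- by rewrite in_itv/= leey andbT; apply: nneseries_ge0 => j _ _; rewrite lee_fin.
- by rewrite in_itv/= lee01 leey.
- by apply/(nneseries_leP 1 (h0 f)); exact: x1.
Qed.

Lemma conj_exponent_gt1 (q : R) : 1 < q -> 1 < conj_exponent q.
Proof.
by move=> q1; rewrite /conj_exponent ltr_pdivlMr ?subr_gt0// mul1r; lra.
Qed.

Lemma cohen_norm_leP V (q : R) (x : nat -> V) (C : R) : 1 < q ->
  (cohen_norm q x <= C%:E)%E <->
  forall f : nat -> dual_space V, weakly_unit (conj_exponent q) f ->
    forall N, \sum_(j < N) rnorm (f j (x j)) <= C.
Proof.
move=> /conj_exponent_gt1 q1; have q0 := lt_trans ltr01 q1.
have h0 (f : nat -> dual_space V) j : 0 <= rnorm (f j (x j)) by exact: rnorm_ge0.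
split => [xC f /weak_norm_le1 f1|xC].
  apply/(nneseries_leP _ (h0 f)); apply: le_trans xC; apply: ereal_sup_ubound.
  by exists f => //=; exact: f1.
apply: ge_ereal_sup => _ [f /= /weak_norm_le1 f1 <-].
by apply/(nneseries_leP _ (h0 f)); apply: xC; exact: f1.
Qed.

Lemma cohen_summableP V (q : R) (x : nat -> V) : 1 < q ->
  cohen_summable q x <->
  exists C, forall f : nat -> dual_space V, weakly_unit (conj_exponent q) f ->
    forall N, \sum_(j < N) rnorm (f j (x j)) <= C.
Proof.
move=> q1; rewrite /cohen_summable; split => [xy|[C /cohen_norm_leP xC]]; last first.
  by apply: le_lt_trans (xC q1) _; rewrite ltry.
have x0 : (0 <= cohen_norm q x)%E.
  apply: (@le_trans _ _ (\sum_(0 <= j <oo) (rnorm ((0 : dual_space V) (x j)))%:E)%E).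
    by apply: nneseries_ge0 => j _ _; rewrite lee_fin rnorm_ge0.
  apply: ereal_sup_ubound; exists (fun=> 0) => //=.
  apply/weak_norm_le1; first exact: lt_trans ltr01 (conj_exponent_gt1 q1).
  move=> f _ N; rewrite big1// => j _.
  have [lf _] := dualP f.
  rewrite (linear_zero lf) rnorm0 powR0// gt_eqF//.
  exact: lt_trans ltr01 (conj_exponent_gt1 q1).
exists (fine (cohen_norm q x)); apply/cohen_norm_leP => //.
by rewrite fineK// ge0_fin_numE.
Qed.

End duality.

(** * The sign-averaging identity *)

Section multilinear.
Context {R : realType} {k : scalar_kind} {n : nat}.
Local Notation K := (scalar_field R k).
Context {E : 'I_n -> completeNormedModType K} {F : completeNormedModType K}.
Implicit Types (x y : forall i, E i) (A : (forall i, E i) -> F).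

Definition separately_linear A :=
  forall (i : 'I_n) x, linear (fun y : E i => A (dfwith x i y)).

(** Multilinear arguments are treated one coordinate at a time: the first m
coordinates of mixed x y m have already been replaced. *)
Definition mixed x y (m : nat) : forall i, E i :=
  fun i => if (i < m)%N then x i else y i.

Lemma dfwith_ext x y (i : 'I_n) :
  (forall j, j != i -> x j = y j) -> x = dfwith y i (x i).
Proof.
move=> xy; apply: functional_extensionality_dep => j.
have [->|ji] := eqVneq j i; first by rewrite dfwithin.
by rewrite dfwithout ?xy// eq_sym.
Qed.

Lemma mixedS x y (i : 'I_n) : mixed x y i.+1 = dfwith (mixed x y i) i (x i).
Proof.
have <- : mixed x y i.+1 i = x i by rewrite /mixed ltnSn.
apply: dfwith_ext => j ji.
by rewrite /mixed ltnS; move: ji; rewrite -val_eqE /=; case: ltngtP.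
Qed.

Lemma mixed_with x y y' (i : 'I_n) : (forall j, j != i -> y j = y' j) ->
  mixed x y i = dfwith (mixed x y' i) i (y i).
Proof.
move=> yy'; have <- : mixed x y i i = y i by rewrite /mixed ltnn.
by apply: dfwith_ext => j ji; rewrite /mixed yy'.
Qed.

Lemma mixed0 x y : mixed x y 0 = y.
Proof. by []. Qed.

Lemma mixed_all x y : mixed x y n = x.
Proof. by apply: functional_extensionality_dep => j; rewrite /mixed ltn_ord. Qed.

Lemma multilinear_scale A (c : K) x : separately_linear A ->
  A (fun i => c *: x i) = c ^+ n *: A x.
Proof.
move=> lA; pose cx i := c *: x i.
suff scale m : (m <= n)%N -> A (mixed cx x m) = c ^+ m *: A x.
  by rewrite -scale// mixed_all.
elim: m => [|m IH] mn; first by rewrite expr0 scale1r mixed0.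
rewrite (mixedS cx x (Ordinal mn)) (linear_scale _ _ (lA _ _)) -mixed_with//.
by rewrite IH ?(ltnW mn)// scalerA -exprS.
Qed.

End multilinear.

Section sign_orthogonality.
Context {R : realType} {k : scalar_kind}.
Local Notation K := (scalar_field R k).

Lemma sign_orthogonality (N : nat) (i j : 'I_N) :
  \sum_(e : {ffun 'I_N -> bool}) (-1) ^+ e i * (-1) ^+ e j =
  (2 ^ N * (i == j))%:R :> K.
Proof.
have [->|ij] := eqVneq i j.
  under eq_bigr => e _ do rewrite -expr2 sqrr_sign.
  by rewrite sumr_const card_ffun card_bool card_ord muln1.
have := sum_resample i (fun e : {ffun 'I_N -> bool} => (-1) ^+ e i * (-1) ^+ e j : K).
rewrite big1 => [/esym/eqP|e _].
  by rewrite card_bool mulrn_eq0 /= muln0 => /eqP.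
by rewrite big_bool /= !ffunE eqxx eq_sym (negbTE ij) expr1 expr0 mulN1r mul1r addNr.
Qed.

Context {n : nat} {E : 'I_n -> completeNormedModType K} {F : completeNormedModType K}.
Variables (N : nat).
Local Notation signs := {ffun 'I_n -> {ffun 'I_N -> bool}}.

Definition sign_sum (x : forall i, nat -> E i) (t : signs) : forall i, E i :=
  fun i => \sum_(j < N) (-1) ^+ t i j *: x i j.

(** The coordinates are averaged one after the other.  Redrawing theta^i expands
the i-th argument of A by linearity, and sign_orthogonality keeps only the term
of index j, so the average does not change when the i-th argument becomes
x i j. *)
Lemma sign_average (A : (forall i, E i) -> F) (x : forall i, nat -> E i) (j : 'I_N) :
  separately_linear A ->
  \sum_(t : signs) (\prod_(i < n) (-1) ^+ t i j) *: A (sign_sum x t) =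
  #|{: signs}|%:R *: A (fun i => x i j).
Proof.
move=> lA; pose xj i := x i j.
pose g m (t : signs) := (\prod_(i < n | (m <= i)%N) (-1) ^+ t i j) *:
   A (mixed xj (sign_sum x t) m).
have gn : \sum_t g n t = #|{: signs}|%:R *: A xj.
  rewrite -sumr_const scaler_suml; apply: eq_bigr => t _.
  rewrite /g mixed_all big_pred0 ?scale1r// => i.
  by rewrite leqNgt ltn_ord.
have step (i : 'I_n) : \sum_t g i t = \sum_t g i.+1 t.
  have N0 : (2 ^ N)%:R != 0 :> K by rewrite pnatr_eq0 expn_eq0.
  apply: (scalerI N0); rewrite !scaler_nat.
  have cardN : #|{ffun 'I_N -> bool}| = (2 ^ N)%N.
    by rewrite card_ffun card_bool card_ord.
  rewrite -[in LHS]cardN -(sum_resample i) -sumrMnl; apply: eq_bigr => t _.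
    (* the signs of the coordinates that have not been averaged yet *)
pose c : K := \prod_(l < n | (i < l)%N) (-1) ^+ t l j.
  pose L (v : E i) := A (dfwith (mixed xj (sign_sum x t) i) i v).
  have lL : linear L by exact: lA.
  have gres s : g i (resample t i s) =
      \sum_(l < N) (c * ((-1) ^+ s j * (-1) ^+ s l)) *: L (x i l).
    rewrite /g (bigD1 i)//= ffunE eqxx.
    rewrite (@mixed_with _ _ _ _ xj _ (sign_sum x t)) => [|l li]; last first.
      by rewrite /sign_sum ffunE (negbTE li).
    rewrite -/(L _) /sign_sum ffunE eqxx (linear_sum_scale _ _ _ lL) scaler_sumr.
    apply: eq_bigr => l _; rewrite scalerA; congr (_ *: _).
    rewrite mulrA [c * _]mulrC; congr (_ * _ * _).
    apply: eq_big => [l'|l' /andP[_ l'i]]; last by rewrite ffunE (negbTE l'i).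
    by rewrite -val_eqE /=; case: ltngtP.
  rewrite (eq_bigr _ (fun s _ => gres s)) exchange_big/=.
  under eq_bigr => l _.
    rewrite -scaler_suml -mulr_sumr sign_orthogonality; over.
  rewrite (bigD1 j)//= eqxx muln1 big1 ?addr0 => [|l lj]; last first.
    by rewrite eq_sym (negbTE lj) muln0 mulr0 scale0r.
  by rewrite /g (mixedS xj _ i) -/(L _) -[in RHS]scaler_nat scalerA [c * _]mulrC.
rewrite -gn; suff gm m : (m <= n)%N -> \sum_t g 0 t = \sum_t g m t.
  by rewrite -(gm n).
elim: m => // m IH mn; rewrite IH ?(ltnW mn)//; exact: (step (Ordinal mn)).
Qed.

End sign_orthogonality.

(** * Automatic uniformity of Cohen summability *)

(** The sets of all l with (e l).1 = m partition nat into infinitely many infinite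
blocks, which carry the gliding hump below. *)
Lemma nneseries_block {R : realType} (e : nat -> nat * nat) (g : nat -> R) (m : nat) :
  bijective e -> (forall j, 0 <= g j) ->
  (\sum_(0 <= l <oo) (if (e l).1 == m then g (e l).2 else 0)%:E =
   \sum_(0 <= j <oo) (g j)%:E)%E.
Proof.
move=> be g0; pose G a b : \bar R := (if a == m then g b else 0)%:E.
have G0 a b : (0 <= G a b)%E by rewrite lee_fin; case: ifP.
rewrite (nneseries_pairs (g := G) be)// [LHS](nneseriesD1 (n := m))// => [|a _]; last first.
  by apply: nneseries_ge0.
rewrite [X in (_ + X)%E]eseries0 ?adde0 => [|a _ am]; last first.
  by rewrite /G (negbTE am) eseries0.
by rewrite /G eqxx.
Qed.

Section uniform_bound.
Context {R : realType} {k : scalar_kind} {n : nat}.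
Local Notation K := (scalar_field R k).
Context {E : 'I_n -> completeNormedModType K} {F : completeNormedModType K}.

Lemma dual_scale {V : normedModType K} (f : dual_space V) (c : K) v :
  f (c *: v) = c *: f v.
Proof. by rewrite (linear_scale _ _ (dualP f).1). Qed.

Lemma scalar_of_expn (a : R) m : scalar_of k a ^+ m = scalar_of k (a ^+ m).
Proof.
elim: m => [|m IH]; first by rewrite !expr0 scalar_of1.
by rewrite !exprS IH scalar_ofM.
Qed.

(** A gliding hump.  If no constant works, for each m there are x^m in the given
bounded set and test functionals whose sum exceeds m 2^(mn).  Place 2^(-m) x^m in
the m-th block of a single sequence: that sequence is still np-summable, and
testing its image against the m-th functionals, placed in the m-th block, gives
more than m because A is homogeneous of degree n.  For large m this exceeds the
Cohen norm of the image, which is finite. *)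
Lemma cohen_multilinear_bound (p B : R) (A : (forall i, E i) -> F) :
  1 < p -> (0 < n)%N -> cohen_multilinear p E F A ->
  exists C, forall x : forall i, nat -> E i,
    (forall i N, \sum_(j < N) rnorm (x i j) `^ (n%:R * p) <= B) ->
    forall f : nat -> dual_space F, weakly_unit (conj_exponent p) f ->
    forall N, \sum_(j < N) rnorm (f j (A (fun i => x i j))) <= C.
Proof.
move=> p1 n0 [[lA cA] AP]; apply: contrapT => /forallNP noC.
have bad m : exists u : (forall i, nat -> E i) * (nat -> dual_space F),
    [/\ forall i N, \sum_(j < N) rnorm (u.1 i j) `^ (n%:R * p) <= B,
        weakly_unit (conj_exponent p) u.2 &
        exists N, m%:R * 2 ^+ (m * n) <
          \sum_(j < N) rnorm (u.2 j (A (fun i => u.1 i j)))].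
  apply: contrapT => /forallNP no; apply: (noC (m%:R * 2 ^+ (m * n))) => x xB f fu N.
  rewrite leNgt; apply/negP => big; apply: (no (x, f)); split=> //=.
  by exists N.
have [u uP] := choice bad.
have [e be] := nat_pairs.
have np1 : 1 <= n%:R * p.
  by rewrite -[leLHS]mulr1 ler_pM ?ler1n ?(ltW p1).
have q0 : 0 < conj_exponent p by apply: lt_trans ltr01 (conj_exponent_gt1 p1).
(* the factors 2^(-m) make the norms summable over the blocks, as np >= 1 *)
pose y i j : E i := scalar_of k (2^-1 ^+ (e j).1) *: (u (e j).1).1 i (e j).2.
have ysum i : lq_summable (n%:R * p) (y i).
  pose G a b : \bar R := (rnorm (scalar_of k (2^-1 ^+ a) *: (u a).1 i b) `^ (n%:R * p))%:E.
  rewrite /lq_summable (nneseries_pairs (g := G) be) => [|a b]; last first.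
    by rewrite lee_fin powR_ge0.
  apply: (@le_lt_trans _ _ (\sum_(0 <= a <oo) (2^-1 ^+ a * B)%:E)%E).
    apply: lee_nneseries => [a _ _|a _]; first by apply: nneseries_ge0 => *; rewrite lee_fin powR_ge0.
    have [uB _ _] := uP a.
    apply/nneseries_leP => [b|N]; first exact: powR_ge0.
    apply: le_trans (_ : 2^-1 ^+ a * \sum_(j < N) rnorm ((u a).1 i j) `^ (n%:R * p) <= _); last first.
      by rewrite ler_wpM2l ?exprn_ge0.
    rewrite mulr_sumr; apply: ler_sum => j _.
    rewrite rnormZ_real ?exprn_ge0// powRM ?exprn_ge0 ?rnorm_ge0//.
    rewrite ler_wpM2r ?powR_ge0// ge1r_powR// exprn_gt0//=.
    by rewrite exprn_ile1// invf_le1// ler1n.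
  have B0 : 0 <= B by have [/(_ i 0%N)] := uP 0%N; rewrite big_ord0.
  apply/nneseries_ltyP => [a|]; first by rewrite mulr_ge0// exprn_ge0.
  exists (2 * B) => N; rewrite -mulr_suml ler_wpM2r//.
  have := @sum_half_pow R N; under eq_bigr => a _ do rewrite exprS.
  by rewrite -mulr_sumr; lra.
have /(cohen_summableP _ p1)[C CP] := AP _ ysum.
(* the block that contradicts the bound C on the Cohen norm of the image of y *)
pose m := Num.bound C.
have [_ uw [N uN]] := uP m.
pose f j : dual_space F := if (e j).1 == m then (u m).2 (e j).2 else 0.
have fu : weakly_unit (conj_exponent p) f.
  move=> g g1.
  apply/(@nneseries_leP _ (fun j => rnorm (g (f j)) `^ conj_exponent p)) => [j|].
    exact: powR_ge0.
  rewrite (eq_eseriesr (g := fun j => (if (e j).1 == m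
      then rnorm (g ((u m).2 (e j).2)) `^ conj_exponent p else 0)%:E)); last first.
    move=> j _; rewrite /f; case: ifP => // _.
    by rewrite (linear_zero (dualP g).1) rnorm0 powR0// gt_eqF.
  rewrite (nneseries_block (g := fun b => rnorm (g ((u m).2 b)) `^ conj_exponent p))//.
    by apply/nneseries_leP => [b|]; [exact: powR_ge0|exact: uw].
  by move=> b; exact: powR_ge0.
pose v b := rnorm ((u m).2 b (A (fun i => scalar_of k (2^-1 ^+ m) *: (u m).1 i b))).
have v0 b : 0 <= v b by exact: rnorm_ge0.
have vC : (\sum_(0 <= b <oo) (v b)%:E <= C%:E)%E.
  rewrite -(nneseries_block m be v0).
  rewrite (eq_eseriesr (g := fun j => (rnorm (f j (A (fun i => y i j))))%:E)).
    by apply/nneseries_leP => [j|]; [exact: rnorm_ge0|exact: CP].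
  by move=> j _; rewrite /f /y /v; case: eqP => [->|_] //; rewrite rnorm0.
have h : 2^-1 ^+ m ^+ n * \sum_(j < N) rnorm ((u m).2 j (A (fun i => (u m).1 i j))) <= C.
  rewrite mulr_sumr; apply: le_trans (_ : \sum_(j < N) v j <= C); last first.
    by move: N {uN}; apply/(nneseries_leP C v0).
  apply: ler_sum => j _; rewrite /v multilinear_scale// scalar_of_expn dual_scale.
  by rewrite rnormZ_real ?exprn_ge0.
have C0 : 0 <= C by apply: le_trans (CP f fu 0%N); rewrite big_ord0.
have := archi_boundP C0; rewrite -/m => Cm.
suff : m%:R < C by rewrite ltNge ltW.
apply: lt_le_trans h; rewrite -exprM exprVn mulrC ltr_pdivlMr ?exprn_gt0//.
Qed.

End uniform_bound.

(** * Cohen strongly summing operators are Cohen almost summing *)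

Section rad_moments.
Context {R : realType} {k : scalar_kind} {V : normedModType (scalar_field R k)}.

Lemma rad_moment (x : nat -> V) (q : R) : Defs.rad x -> 0 <= q ->
  exists B : R, forall N, signavg (mkseq x N) (fun v => rnorm v `^ q) 0 <= B.
Proof.
move=> /rad_tail[M tM] q0.
exists (1 + M.+1%:R ^+ (Num.bound q) * moment_bound (Num.bound q)) => N.
apply: kahane_powR => //; last exact/ltW/archi_boundP.
apply: le_trans (tM N); apply: le_signavg => v; rewrite /exceeds ler_nat.
case: (ltP M.+1%:R) => // vM; case: ltP => // vM'.
have := lt_le_trans vM vM'; rewrite ltr_nat; lia.
Qed.

End rad_moments.

Section marginals.
Context {R : realType}.

Lemma sum_marginal (I T : finType) (i : I) (H : T -> R) :
  (\sum_(t : {ffun I -> T}) H (t i)) *+ #|T| =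
  (\sum_s H s) *+ #|{ffun I -> T}|.
Proof.
rewrite -(sum_resample i) -sumr_const; apply: eq_bigr => t _.
by apply: eq_bigr => s _; rewrite ffunE eqxx.
Qed.

Context {n N : nat}.
Local Notation signs := {ffun 'I_n -> {ffun 'I_N -> bool}}.

Definition sign_product (t : signs) : {ffun 'I_N -> bool} :=
  [ffun j => \big[addb/false]_i t i j].

Lemma sign_productE (K : pzRingType) (t : signs) j :
  (-1) ^+ sign_product t j = \prod_(i < n) (-1) ^+ t i j :> K.
Proof.
rewrite ffunE.
by apply: (big_morph (fun b : bool => (-1) ^+ b)) => [b c|//]; exact: signr_addb.
Qed.

(** A product of independent random signs is again a random sign: translate by the
product of all the factors except one. *)
Lemma sum_sign_product (H : {ffun 'I_N -> bool} -> R) : (0 < n)%N ->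
  (\sum_(t : signs) H (sign_product t)) *+ 2 ^ N = (\sum_s H s) *+ #|{: signs}|.
Proof.
move=> n0; have cardN : #|{ffun 'I_N -> bool}| = (2 ^ N)%N.
  by rewrite card_ffun card_bool card_ord.
pose i := Ordinal n0.
rewrite -cardN -(sum_resample i) -sumr_const; apply: eq_bigr => t _.
pose rest : {ffun 'I_N -> bool} := [ffun j => \big[addb/false]_(l | l != i) t l j].
pose flip (s : {ffun 'I_N -> bool}) : {ffun 'I_N -> bool} := [ffun j => s j (+) rest j].
have flipK : involutive flip by move=> s; apply/ffunP => j; rewrite !ffunE addbK.
rewrite [RHS](reindex_inj (inv_inj flipK)) /=; apply: eq_bigr => s _; congr H.
apply/ffunP => j; rewrite !ffunE (bigD1 i)//= ffunE eqxx; congr (_ (+) _).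
by apply: eq_bigr => l li; rewrite ffunE (negbTE li).
Qed.

End marginals.

Section cohen_multilinear_almost_summing.
Context {R : realType} {k : scalar_kind} {n : nat}.
Local Notation K := (scalar_field R k).
Context {E : 'I_n -> completeNormedModType K} {F : completeNormedModType K}.

Lemma cohen_multilinear_bound_fin (p B : R) (A : (forall i, E i) -> F) :
  1 < p -> (0 < n)%N -> cohen_multilinear p E F A ->
  exists C, forall (T : finType) (x : T -> forall i, E i) (f : T -> dual_space F),
    (forall i, \sum_t rnorm (x t i) `^ (n%:R * p) <= B) ->
    (forall g : dual_space (dual_space F), rnorm g <= 1 ->
      \sum_t rnorm (g (f t)) `^ conj_exponent p <= 1) ->
    \sum_t rnorm (f t (A (x t))) <= C.
Proof.
move=> p1 n0 AP; have [C CP] := cohen_multilinear_bound B p1 n0 AP.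
have q0 : conj_exponent p != 0.
  by rewrite gt_eqF// (lt_trans ltr01)// conj_exponent_gt1.
have np0 : n%:R * p != 0 by rewrite mulf_neq0// ?pnatr_eq0 -?lt0n// gt_eqF// (lt_trans ltr01).
exists C => T x f xB f1.
pose y i j : E i := oapp (x^~ i) 0 (listing T j).
pose h j : dual_space F := oapp f 0 (listing T j).
have yB i N : \sum_(j < N) rnorm (y i j) `^ (n%:R * p) <= B.
  apply: le_trans (xB i).
  apply: le_trans (le_sum_listing N _); last by move=> t; exact: powR_ge0.
  apply: ler_sum => j _; rewrite /y; case: listing => //=.
  by rewrite rnorm0 powR0.
have hu : weakly_unit (conj_exponent p) h.
  move=> g g1 N; apply: le_trans (f1 g g1).
  apply: le_trans (le_sum_listing N _); last by move=> t; exact: powR_ge0.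
  apply: ler_sum => j _; rewrite /h; case: listing => //=.
  by rewrite (linear_zero (dualP g).1) rnorm0 powR0.
apply: le_trans (CP y yB h hu #|T|); rewrite -sum_listing; apply: ler_sum => j _.
by rewrite /h /y /listing valK.
Qed.

Lemma weakly_unit_phase {V : normedModType K} (q : R) (f : nat -> dual_space V) (c : nat -> K) :
  (forall j, rnorm (c j : K^o) = 1) -> weakly_unit q f ->
  weakly_unit q (fun j => c j *: f j).
Proof.
move=> c1 fu g g1 N; apply: le_trans (fu g g1 N); apply: ler_sum => j _.
by rewrite dual_scale rnormZ c1 mul1r.
Qed.

Lemma dual_sum_apply (V : normedModType K) (I : finType) (c : I -> K)
    (f : I -> dual_space V) v :
  (\sum_i c i *: f i) v = \sum_i c i *: f i v.
Proof. by elim/big_rec2: _ => [//|i a w _ <-]. Qed.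

Lemma dual_sum (V : normedModType K) (I : finType) (f : dual_space V) (u : I -> V) :
  f (\sum_i u i) = \sum_i f (u i).
Proof.
elim/big_rec2: _ => [|i w v _ <-]; first exact: linear_zero (dualP f).1.
by have := (dualP f).1 1 (u i) v; rewrite !scale1r.
Qed.

Lemma scalar_of_nat (m : nat) : scalar_of k (m%:R : R) = m%:R.
Proof.
by elim: m => [|m IH]; rewrite ?scalar_of0// -!natr1 scalar_ofD IH scalar_of1.
Qed.

(** The sum over j is still inside the norm here, which makes it the mean of
Phi (A X) over all sign patterns, by sign_average.  The family of sign patterns
is normalized so that the bound for finite families applies: with w the weight of
one pattern, X is scaled by w^(1/(np)) and Phi by w^(1/q), and these contribute
w^(1/p) w^(1/q) = w in total because A has degree n.  The extra factor
Kq^(-1/q) in Phi brings the Khinchin constant down to 1. *)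
Lemma cohen_multilinear_rad_bound (p B : R) (A : (forall i, E i) -> F) :
  1 < p -> (0 < n)%N -> cohen_multilinear p E F A ->
  exists C, forall x : forall i, nat -> E i,
    (forall i N, signavg (mkseq (x i) N) (fun v => rnorm v `^ (n%:R * p)) 0 <= B) ->
    forall f : nat -> dual_space F, weakly_unit 2 f ->
    forall N, rnorm (\sum_(j < N) f j (A (fun i => x i j))) <= C.
Proof.
move=> p1 n0 AP; have [C CP] := cohen_multilinear_bound_fin B p1 n0 AP.
have lA := AP.1.1.
set q := conj_exponent p in CP.
have p0 : 0 < p := lt_trans ltr01 p1.
have q0 : 0 < q by rewrite (lt_trans ltr01)// conj_exponent_gt1.
have np0 : 0 < n%:R * p by rewrite mulr_gt0// ltr0n.
pose D := Num.bound q.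
pose Kq : R := 1 + 4 ^+ D * moment_bound D.
have Kq0 : 0 < Kq by rewrite ltr_pwDl// mulr_ge0 ?exprn_ge0// moment_bound_ge0.
exists (C * Kq `^ q^-1) => x xB f fu N.
pose signs := {ffun 'I_n -> {ffun 'I_N -> bool}}.
(* the number of sign patterns is named by an equation only, so that it is never
   unfolded *)
have [S SE] : exists S, S = #|{: signs}| by exists #|{: signs}|.
pose w : R := S%:R^-1.
have S0 : 0 < S%:R :> R.
  by rewrite SE ltr0n card_ffun expn_gt0 card_ffun card_bool card_ord expn_gt0.
have w0 : 0 < w by rewrite invr_gt0.
have N0 : (0 : R) < 2 ^+ N by rewrite exprn_gt0.
(* w times a sum over sign patterns is the mean b of a function H of a single
   random sign vector *)
have mean (G : signs -> R) (H : {ffun 'I_N -> bool} -> R) (b : R) :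
    (\sum_t G t) *+ 2 ^ N = (\sum_s H s) *+ S ->
    \sum_s H s = 2 ^+ N * b -> \sum_t G t = w^-1 * b.
  move=> GH Hb; move: GH; rewrite Hb -(mulr_natr _ (2 ^ N)) -(mulr_natr _ S).
  rewrite (natrX R 2 N) /w invrK => GH.
  by apply: (mulIf (lt0r_neq0 N0)); rewrite GH; ring.
pose d : R := w `^ (n%:R * p)^-1.
pose c : R := w `^ q^-1 / Kq `^ q^-1.
pose Phi (t : signs) : dual_space F := \sum_(j < N) (\prod_(i < n) (-1) ^+ t i j) *: f j.
have d0 : 0 <= d by exact: powR_ge0.
have c0 : 0 <= c by rewrite divr_ge0 ?powR_ge0.
have key : d ^+ n * c * \sum_t rnorm (Phi t (A (sign_sum x t))) <= C.
  rewrite mulr_sumr; apply: le_trans (CP signs (fun t i => scalar_of k d *: sign_sum x t i)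
   (fun t => scalar_of k c *: Phi t) _ _).
  - apply: ler_sum => t _; rewrite multilinear_scale// scalar_of_expn dual_scale.
    rewrite -[(scalar_of k c *: Phi t) _]/(scalar_of k c *: Phi t _).
    by rewrite !rnormZ_real ?exprn_ge0// mulrA.
  - move=> i; apply: le_trans (xB i N).
    rewrite (eq_bigr (fun t => w * rnorm (sign_sum x t i) `^ (n%:R * p))) => [|t _]; last first.
      rewrite rnormZ_real// powRM ?rnorm_ge0// /d -powRrM mulVf ?gt_eqF//.
      by rewrite powRr1 ?ltW.
    rewrite -mulr_sumr (mean _ (fun s => rnorm (\sum_(j < N) (-1) ^+ s j *: x i j) `^ (n%:R * p))
      (signavg (mkseq (x i) N) (fun v => rnorm v `^ (n%:R * p)) 0)).
    + by rewrite mulrA mulfV ?mul1r// gt_eqF.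
    + rewrite SE -(sum_marginal i); congr (_ *+ _).
      by rewrite card_ffun card_bool card_ord.
    + exact: (sum_signs N (x i) (fun v => rnorm v `^ (n%:R * p))).
  - move=> g g1.
    pose a j : K^o := g (f j).
    rewrite (eq_bigr (fun t => w / Kq *
        rnorm (\sum_(j < N) (-1) ^+ sign_product t j *: a j) `^ q)) => [|t _]; last first.
      rewrite dual_scale rnormZ_real// powRM ?rnorm_ge0// /c.
      rewrite powRM ?powR_ge0 ?invr_ge0 ?powR_ge0//.
      congr (_ * _ * _ `^ q).
      - by rewrite -powRrM mulVf ?gt_eqF// powRr1 ?ltW.
      - rewrite -powRN -powRrM mulNr mulVf ?gt_eqF// powR_inv1 ?ltW//.
      - congr rnorm; rewrite /Phi (linear_sum_scale _ _ _ (dualP g).1).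
        by apply: eq_bigr => j _; rewrite sign_productE.
    rewrite -mulr_sumr (mean _ (fun s => rnorm (\sum_(j < N) (-1) ^+ s j *: a j) `^ q)
      (signavg (mkseq a N) (fun v => rnorm v `^ q) 0)).
    + rewrite mulrA (mulrAC w) divff ?gt_eqF// mul1r mulrC ler_pdivrMr// mul1r.
      apply: khinchin; [|exact: ltW|exact/ltW/archi_boundP/ltW].
      rewrite big_map (_ : iota 0 N = index_iota 0 N) ?big_mkord; last first.
        by rewrite /index_iota subn0.
      apply: le_trans (fu g g1 N); apply: ler_sum => j _.
      by rewrite -[2]/(2%:R) powR_mulrn ?rnorm_ge0.
    + rewrite SE; exact: (sum_sign_product (fun s => rnorm (\sum_(j < N) (-1) ^+ s j *: a j) `^ q)).
    + exact: (sum_signs N a (fun v => rnorm v `^ q)).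
have dc : d ^+ n * c = w / Kq `^ q^-1.
  rewrite /c mulrA; congr (_ / _); rewrite -powR_mulrn// /d -powRrM -powRD; last first.
    by rewrite (gt_eqF w0) implybT.
  rewrite -[RHS]powRr1 ?ltW//; congr (_ `^ _).
  rewrite invfM mulrAC mulVf ?pnatr_eq0 -?lt0n// mul1r /q /conj_exponent invf_div.
  by field; rewrite gt_eqF.
have avg : \sum_t Phi t (A (sign_sum x t)) =
    S%:R *: \sum_(j < N) f j (A (fun i => x i j)).
  transitivity (\sum_(t : signs) \sum_(j < N)
      f j ((\prod_(i < n) (-1) ^+ t i j) *: A (sign_sum x t))).
    by apply: eq_bigr => t _; rewrite dual_sum_apply; apply: eq_bigr => j _; rewrite dual_scale.
  rewrite exchange_big scaler_sumr; apply: eq_bigr => j _.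
  by rewrite -dual_scale SE -(sign_average x j lA) dual_sum.
have Sk : S%:R = scalar_of k (w^-1).
  by rewrite /w invrK scalar_of_nat.
rewrite -ler_pdivrMr ?powR_gt0//; apply: le_trans key; rewrite dc mulrAC ler_pM2r ?invr_gt0 ?powR_gt0//.
rewrite -ler_pdivrMl// -rnormZ_real ?invr_ge0 ?(ltW w0)// -Sk -avg.
exact: rnorm_sum.
Qed.

(** Multiplying the test functionals by phases turns the norm of the sum, bounded
in cohen_multilinear_rad_bound, into the sum of the norms. *)
Lemma cohen_multilinear_almost_summing (p : R) (A : (forall i, E i) -> F) :
  1 < p -> (0 < n)%N -> cohen_multilinear p E F A -> cohen_almost_summing E F A.
Proof.
move=> p1 n0 AP; split; first exact: AP.1.
move=> x xrad.
have np0 : 0 <= n%:R * p by rewrite mulr_ge0// ltW// (lt_trans ltr01).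
have [b bP] := choice (fun i => rad_moment (xrad i) np0).
have [C CP] := cohen_multilinear_rad_bound (\sum_i `|b i|) p1 n0 AP.
apply/cohen_summableP; first by rewrite ltr1n.
have -> : conj_exponent 2 = 2 :> R by rewrite /conj_exponent; field.
exists C => f fu N.
pose y j := A (fun i => x i j).
have [c cP] := choice (fun j => exists_phase (f j (y j))).
have := CP x _ _ (weakly_unit_phase (fun j => (cP j).1) fu) N.
rewrite (_ : \sum_(j < N) _ = scalar_of k (\sum_(j < N) rnorm (f j (y j)))).
  rewrite rnorm_scalar_of ?sumr_ge0// => [|j _]; last exact: rnorm_ge0.
  apply=> i M; apply: le_trans (bP i M) _; rewrite (le_trans (ler_norm _))//.
  by rewrite (bigD1 i)//= lerDl sumr_ge0.
elim/big_rec2: _ => [|j a z _ ->]; first by rewrite scalar_of0.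
by rewrite scalar_ofD; congr (_ + _); exact: (cP j).2.
Qed.

End cohen_multilinear_almost_summing.

(** * Continuity of multilinear maps *)

Section product_topology.

Lemma prod_topology_cvg (I : Type) (T : I -> topologicalType)
    (F : set_system (prod_topology T)) (x : prod_topology T) :
  Filter F -> (forall i, (fun f : prod_topology T => f i) @ F --> x i) -> F --> x.
Proof.
move=> FF Fx; apply/cvg_sup => i U.
have /= -> := @nbhsE (initial_topology (fun f : prod_topology T => f i)) x.
case=> B [[C oC <-] Cx] /filterS; apply.
by apply: Fx; apply: open_nbhs_nbhs; split.
Qed.

Lemma prod_topology_continuous (I : eqType) (S T : I -> topologicalType)
    (f : forall i, S i -> T i) : (forall i, continuous (f i)) ->
  continuous ((fun x i => f i (x i)) : prod_topology S -> prod_topology T).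
Proof.
move=> cf x; apply: prod_topology_cvg => [|i].
  exact: (@fmap_filter _ _ _ _ (nbhs_filter (x : prod_topology S))).
exact: (continuous_comp (@proj_continuous I S i x) (cf i (x i))).
Qed.

End product_topology.

Section multilinear_bounded.
Context {R : realType} {k : scalar_kind} {n : nat}.
Local Notation K := (scalar_field R k).
Context {E : 'I_n -> completeNormedModType K} {F : completeNormedModType K}.

(** Unboundedness on all small boxes would yield a null sequence with images away
from the image of the origin; larger boxes follow by homogeneity. *)
Lemma multilinear_box_bound (A : (forall i, E i) -> F) (r : R) : 0 < r ->
  continuous_multilinear E F A ->
  exists M : R, 0 < M /\
    forall z : forall i, E i, (forall i, rnorm (z i) <= r) -> rnorm (A z) <= M.
Proof.
move=> r0 [lA cA]; pose M0 : R := 1 + rnorm (A (fun=> 0)).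
have M00 : 0 < M0 by rewrite ltr_pwDl// rnorm_ge0.
have [d [d0 dA]] : exists d : R, 0 < d /\
    forall z : forall i, E i, (forall i, rnorm (z i) <= d) -> rnorm (A z) <= M0.
  apply: contrapT => /forallNP nod.
  have bad (m : nat) : exists z : forall i, E i,
      (forall i, rnorm (z i) <= m.+1%:R^-1) /\ M0 < rnorm (A z).
    apply: contrapT => /forallNP noz; apply: (nod m.+1%:R^-1); split.
      by rewrite invr_gt0.
    by move=> z zd; rewrite leNgt; apply/negP => Az; apply: (noz z).
  have [z zP] := choice bad.
  have zcvg : (z : nat -> prod_topology E) @ \oo --> ((fun=> 0) : prod_topology E).
    apply: prod_topology_cvg => i.
    apply/(@cvgrPdist_le K (E i) nat \oo) => e e0.
    have e0' : 0 < scalar_re e.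
      by rewrite ltNge -(@ler_scalar_of R k) (scalar_reK (ltW e0)) scalar_of0 (lt_geF e0).
    exists (Num.bound (scalar_re e)^-1) => // m /= bm; rewrite sub0r normrN.
    apply: (@le_trans _ _ (scalar_of k m.+1%:R^-1)).
      by rewrite -scalar_of_rnorm ler_scalar_of; exact: (zP m).1.
    rewrite -(scalar_reK (ltW e0)) ler_scalar_of.
    rewrite invf_ple ?posrE// (le_trans (ltW (archi_boundP _)))// ?invr_ge0 ?ltW//.
    by rewrite ltr_nat ltnS.
  have := cvg_comp _ _ zcvg (cA (fun=> 0)).
  move=> /(@cvgrPdist_le K F nat \oo)/(_ 1 ltr01)/filter_ex[m /= Am].
  have := (zP m).2; rewrite ltNge => /negP; apply.
  rewrite -(subrK (A (fun=> 0)) (A (z m))) (le_trans (ler_rnormD _ _))// lerD2r.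
  by rewrite -(@ler_scalar_of R k) scalar_of_rnorm scalar_of1 distrC.
exists ((r / d) ^+ n * M0); split; first by rewrite mulr_gt0// exprn_gt0// divr_gt0.
move=> z zr.
have c0 : 0 < r / d by rewrite divr_gt0.
have c0' : 0 < d / r by rewrite divr_gt0.
have := dA (fun i => scalar_of k (d / r) *: z i).
rewrite multilinear_scale// scalar_of_expn rnormZ_real ?exprn_ge0 ?(ltW c0')//.
rewrite -{2}[d / r]invf_div exprVn ler_pdivrMl ?exprn_gt0//; apply=> i.
by rewrite rnormZ_real ?(ltW c0')// mulrAC ler_pdivrMr// ler_pM2l.
Qed.

End multilinear_bounded.

(** * Test functionals *)

Section weak_tools.
Context {R : realType} {k : scalar_kind}.
Local Notation K := (scalar_field R k).
Implicit Types V W : normedModType K.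

Lemma dual_linear {V} (f : dual_space V) : linear f.
Proof. exact: (dualP f).1. Qed.

Lemma dual_ext V (f g : dual_space V) : (forall v, f v = g v) -> f = g.
Proof. by move=> fg; apply: val_inj; apply: funext. Qed.

(** Evaluation at a point of the unit ball is an admissible test in the bidual. *)
Lemma weakly_unit_le1 V (f : nat -> dual_space V) j :
  weakly_unit 2 f -> rnorm (f j) <= 1.
Proof.
move=> fu; apply: dual_norm_le_rnorm => v v1.
have lev : linear (fun g : dual_space V => g v) by [].
have evb (g : dual_space V) : rnorm (g v : K^o) <= 1 * rnorm g.
  rewrite mul1r (le_trans (dual_ubound _ _))// ler_piMr// rnorm_ge0//.
have [ev [evE ev1]] := exists_dual lev evb ler01.
have := fu ev ev1 j.+1; rewrite big_ord_recr/= evE.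
rewrite -[2]/(2%:R) powR_mulrn ?rnorm_ge0// => h.
rewrite -(@expr_le1 _ 2)// ?rnorm_ge0//; apply: le_trans h.
by rewrite lerDr sumr_ge0// => i _; exact: powR_ge0.
Qed.

Lemma weakly_unit_l2 V (f : nat -> dual_space V) :
  (forall N, \sum_(j < N) rnorm (f j) ^+ 2 <= 1) -> weakly_unit 2 f.
Proof.
move=> f1 g g1 N; apply: le_trans (f1 N); apply: ler_sum => j _.
rewrite -[2]/(2%:R) powR_mulrn ?rnorm_ge0// lerXn2r ?nnegrE ?rnorm_ge0//.
by rewrite (le_trans (dual_ubound _ _))// ler_piMl ?rnorm_ge0.
Qed.

(** A functional h on the dual of V gives w |-> h (w o T) on the dual of W. *)
Lemma weakly_unit_pullback V W (T : V -> W) (q : R) (f : nat -> dual_space W)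
    (g : nat -> dual_space V) :
  linear T -> (forall v, rnorm (T v) <= rnorm v) ->
  (forall j v, g j v = f j (T v)) -> weakly_unit q f -> weakly_unit q g.
Proof.
move=> lT T1 gE fu h h1.
have pull (w : dual_space W) : exists w' : dual_space V,
    (forall v, w' v = w (T v)) /\ rnorm w' <= rnorm w.
  apply: exists_dual; last exact: rnorm_ge0.
    by move=> a u v; rewrite lT dual_linear.
  by move=> v; rewrite (le_trans (dual_ubound _ _))// ler_wpM2l ?rnorm_ge0.
have [P PP] := choice pull.
have lh : linear (fun w => h (P w)).
  move=> a u v; rewrite -dual_linear; congr (h _); apply: dual_ext => w.
  by rewrite (PP _).1 -[RHS]/(a *: P u w + P v w) !(PP _).1.
have hb w : rnorm (h (P w)) <= 1 * rnorm w.
  rewrite mul1r (le_trans (dual_ubound _ _))//.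
  by rewrite (le_trans _ (PP w).2)// ler_piMl// rnorm_ge0.
have [h' [h'E h'1]] := exists_dual lh hb ler01.
move=> N; apply: le_trans (fu h' h'1 N); apply: ler_sum => j _.
rewrite h'E (_ : P (f j) = g j)//; apply: dual_ext => v.
by rewrite gE (PP _).1.
Qed.

(** Duality in l_2: test y against the functionals f j scaled by the normalized
sequence of the numbers |f j (y j)| itself. *)
Lemma cohen_l2 V (y : nat -> V) (c M : R) (f : nat -> dual_space V) N :
  (forall g : nat -> dual_space V, weakly_unit 2 g -> forall N, \sum_(j < N) rnorm (g j (y j)) <= c) ->
  0 < M -> (forall j, rnorm (f j) <= M) ->
  \sum_(j < N) rnorm (f j (y j)) ^+ 2 <= (c * M) ^+ 2.
Proof.
move=> yc M0 fM; pose T2 := \sum_(j < N) rnorm (f j (y j)) ^+ 2.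
have T20 : 0 <= T2 by apply: sumr_ge0 => j _; rewrite exprn_ge0 ?rnorm_ge0.
pose T := Num.sqrt T2; have TT : T ^+ 2 = T2 by rewrite sqr_sqrtr.
have c0 : 0 <= c.
  apply: le_trans (yc (fun=> 0) _ 0%N); rewrite ?big_ord0//.
  by apply: weakly_unit_l2 => m; rewrite big1// => j _; rewrite rnorm0 expr0n.
rewrite -/T2 -TT lerXn2r ?nnegrE ?sqrtr_ge0 ?mulr_ge0 ?(ltW M0)//.
have [T0|T0] := leP T 0; first by rewrite (le_trans T0)// mulr_ge0 ?(ltW M0).
(* (b j * M)_j is the unit vector of l_2 against which the sequence of the
   |f j (y j)| attains its norm T *)
pose b j : R := if (j < N)%N then rnorm (f j (y j)) / (T * M) else 0.
have b0 j : 0 <= b j.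
  by rewrite /b; case: ifP => // _; rewrite divr_ge0 ?rnorm_ge0// mulr_ge0 ?ltW.
have gu : weakly_unit 2 (fun j => scalar_of k (b j) *: f j).
  apply: weakly_unit_l2 => m.
  apply: (@le_trans _ _ (\sum_(j < N + m) (b j * M) ^+ 2)).
    apply: (@le_trans _ _ (\sum_(j < m) (b j * M) ^+ 2)).
      apply: ler_sum => j _; rewrite rnormZ_real// lerXn2r ?nnegrE ?mulr_ge0 ?rnorm_ge0 ?(ltW M0)//.
      by rewrite ler_wpM2l.
    rewrite addnC big_split_ord/= lerDl sumr_ge0// => j _.
    by rewrite exprn_ge0// mulr_ge0 ?(ltW M0).
  rewrite big_split_ord/= [X in _ + X]big1 ?addr0 => [|j _]; last first.
    by rewrite /b ltnNge leq_addr/= mul0r expr0n.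
  rewrite (eq_bigr (fun j : 'I_N => rnorm (f j (y j)) ^+ 2 / T2)) => [|j _].
    by rewrite -mulr_suml -/T2 divff// -TT expf_neq0 ?gt_eqF.
  rewrite /b ltn_ord -TT -expr_div_n; congr (_ ^+ 2).
  by field; rewrite !gt_eqF.
have := yc _ gu N.
rewrite (eq_bigr (fun j : 'I_N => rnorm (f j (y j)) ^+ 2 / (T * M))) => [|j _]; last first.
  by rewrite -[(_ *: f j) _]/(scalar_of k (b j) *: f j (y j)) rnormZ_real// /b ltn_ord; ring.
rewrite -mulr_suml -/T2 -TT expr2 -mulf_div divff ?gt_eqF// mul1r.
by rewrite ler_pdivrMr.
Qed.

Lemma dual_almost_norming V (f : dual_space V) :
  exists v, rnorm v <= 1 /\ rnorm f <= 2 * rnorm (f v).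
Proof.
apply: contrapT => /forallNP nov.
have f2 : rnorm f <= rnorm f / 2.
  apply: dual_norm_le_rnorm => v v1; rewrite ler_pdivlMr// mulrC.
  by rewrite leNgt; apply/negP => h; apply: (nov v); split=> //; exact: ltW.
have f0 : rnorm f = 0 by have := rnorm_ge0 f; lra.
apply: (nov 0); rewrite f0 rnorm0; split=> //.
by rewrite mulr_ge0 ?rnorm_ge0.
Qed.

End weak_tools.

(** * Compositions with a continuous multilinear operator *)

Section compositions.
Context {R : realType} {k : scalar_kind}.
Local Notation K := (scalar_field R k).

(** A linear operator is a 1-linear one. *)
Lemma cohen_operator_rad (p : R) (E F : completeNormedModType K) (u : E -> F)
    (x : nat -> E) :
  1 < p -> cohen_operator p E F u -> Defs.rad x -> cohen_summable 2 (u \o x).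
Proof.
move=> p1 [lu cu uP] xrad.
pose A (z : forall i : 'I_1, E) := u (z ord0).
have AP : cohen_multilinear p (fun=> E) F A.
  split; [split|].
  - move=> i z a y y'; rewrite (ord1 i) /A.
    by rewrite !dfwithin lu.
  - move=> z; apply: (continuous_comp (@proj_continuous _ (fun=> E) ord0 z)).
    exact: cu.
  - move=> y ysum; apply: (uP (y ord0)).
    by have := ysum ord0; rewrite mul1r.
have [_ AS] := cohen_multilinear_almost_summing p1 (ltn0Sn 0) AP.
exact: (AS (fun=> x)).
Qed.

Lemma continuous_multilinear_comp n (E G : 'I_n -> completeNormedModType K)
    (F : completeNormedModType K) (u : forall i, E i -> G i) (B : (forall i, G i) -> F) :
  (forall i, linear (u i)) -> (forall i, continuous (u i)) ->
  continuous_multilinear G F B ->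
  continuous_multilinear E F (fun x => B (fun i => u i (x i))).
Proof.
move=> lu cu [lB cB]; split.
  move=> i x a y y'.
  have uE v : (fun j => u j (dfwith x i v j)) = dfwith (fun j => u j (x j)) i (u i v).
    apply: functional_extensionality_dep => j.
    have [<-|ij] := eqVneq i j; first by rewrite !dfwithin.
    by rewrite !dfwithout.
  by rewrite !uE lu lB.
move=> x.
have cux := @prod_topology_continuous _ (fun i => E i) (fun i => G i) u cu x.
exact: (cvg_comp _ _ cux (cB (fun i => u i (x i)))).
Qed.

Lemma unilinear_image (G : 'I_1 -> completeNormedModType K)
    (F : completeNormedModType K) (B : (forall i, G i) -> F)
    (y : forall i, nat -> G i) :
  continuous_multilinear G F B -> (forall i, cohen_summable 2 (y i)) ->
  cohen_summable 2 (fun j => B (fun i => y i j)).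
Proof.
move=> cmB ysum; have [lB _] := cmB.
have q1 : (1 : R) < 2 by rewrite ltr1n.
have q2 : conj_exponent 2 = 2 :> R by rewrite /conj_exponent; field.
have [M [M0 BM]] := multilinear_box_bound ltr01 cmB.
have [c] := (cohen_summableP _ q1).1 (ysum ord0).
rewrite q2 => yc; apply/(cohen_summableP _ q1); rewrite q2.
pose z0 : forall i, G i := fun=> 0.
pose L (v : G ord0) := B (dfwith z0 ord0 v).
have lL : linear L by exact: lB.
have LM v : rnorm (L v) <= M * rnorm v.
  apply: bounded_of_ball v => // v v1; apply: BM => i.
  by rewrite (ord1 i) dfwithin.
have BL j : B (fun i => y i j) = L (y ord0 j).
  congr B; apply: functional_extensionality_dep => i.
  by rewrite (ord1 i) dfwithin.
exists (M * c) => f fu N.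
pose T v := scalar_of k M^-1 *: L v.
have lT : linear T by move=> a v w; rewrite /T lL scalerDr !scalerA mulrC.
have T1 v : rnorm (T v) <= rnorm v.
  by rewrite rnormZ_real ?invr_ge0 ?(ltW M0)// ler_pdivrMl.
have pull j : exists g : dual_space (G ord0), (forall v, g v = f j (T v)) /\ rnorm g <= rnorm (f j).
  apply: exists_dual; last exact: rnorm_ge0.
    by move=> a v w; rewrite lT dual_linear.
  by move=> v; rewrite (le_trans (dual_ubound _ _))// ler_wpM2l ?rnorm_ge0.
have [g gP] := choice pull.
have gu := weakly_unit_pullback lT T1 (fun j => (gP j).1) fu.
have := yc g gu N.
rewrite (eq_bigr (fun j : 'I_N => M^-1 * rnorm (f j (L (y ord0 j))))) => [|j _]; last first.
  by rewrite (gP j).1 /T dual_scale rnormZ_real ?invr_ge0 ?(ltW M0).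
rewrite -mulr_sumr ler_pdivrMl// => h; apply: le_trans h.
by apply: ler_sum => j _; rewrite BL.
Qed.

(** Two Cohen summable coordinates compensate for each other.  With h j the
bilinear map in the coordinates i0 and i1 obtained by freezing the others, the
functionals h j (a j, .) are bounded, so cohen_l2 for y i1 bounds the sum of
the |h j (a j, y i1 j)|^2 for every choice of a j in the unit ball.  For almost
norming a j these numbers dominate, up to a factor 4, the squared norms of the
functionals g j = h j (., y i1 j), which are thus weakly 2-summable and can be
used to test y i0. *)
Lemma multilinear_image n (G : 'I_n -> completeNormedModType K)
    (F : completeNormedModType K) (B : (forall i, G i) -> F)
    (y : forall i, nat -> G i) (r : R) (i0 i1 : 'I_n) : i0 != i1 ->
  continuous_multilinear G F B -> (forall i j, rnorm (y i j) <= r) ->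
  cohen_summable 2 (y i0) -> cohen_summable 2 (y i1) ->
  cohen_summable 2 (fun j => B (fun i => y i j)).
Proof.
move=> i01 cmB yr y0 y1; have [lB _] := cmB.
have q1 : (1 : R) < 2 by rewrite ltr1n.
have q2 : conj_exponent 2 = 2 :> R by rewrite /conj_exponent; field.
have r0 : 0 < Num.max 1 r by rewrite lt_max ltr01.
have [M [M0 BM]] := multilinear_box_bound r0 cmB.
have [c0] := (cohen_summableP _ q1).1 y0.
have [c1] := (cohen_summableP _ q1).1 y1.
rewrite q2 => yc1 yc0; apply/(cohen_summableP _ q1); rewrite q2.
have c1_ge0 : 0 <= c1.
  apply: le_trans (yc1 (fun=> 0) _ 0%N); rewrite ?big_ord0//.
  by apply: weakly_unit_l2 => m; rewrite big1// => j _; rewrite rnorm0 expr0n.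
(* the summand 1 keeps C positive when c1 vanishes *)
pose C := 2 * (c1 * M) + 1.
have C0 : 0 < C by rewrite ltr_wpDl// mulr_ge0// mulr_ge0// ltW.
exists (C * c0) => f fu N.
pose Y j : forall i, G i := fun i => y i j.
pose h j a b := B (dfwith (dfwith (Y j) i0 a) i1 b).
have hM j a b : rnorm a <= 1 -> rnorm b <= Num.max 1 r -> rnorm (h j a b) <= M.
  move=> a1 b1; apply: BM => i.
  have [<-|ii1] := eqVneq i1 i; first by rewrite dfwithin.
  rewrite dfwithout//; have [<-|ii0] := eqVneq i0 i.
    by rewrite dfwithin (le_trans a1)// le_max lexx.
  by rewrite dfwithout// (le_trans (yr _ _))// le_max lexx orbT.
have f1 j v : rnorm (f j v) <= rnorm v.
  by rewrite (le_trans (dual_ubound _ _))// ler_piMl ?rnorm_ge0// (weakly_unit_le1 _ fu).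
have psi j : exists g : dual_space (G i0), (forall a, g a = f j (h j a (Y j i1))) /\ rnorm g <= M.
  have hE a : h j a (Y j i1) = B (dfwith (Y j) i0 a).
    congr B; apply: functional_extensionality_dep => i.
    have [<-|ii1] := eqVneq i1 i; first by rewrite dfwithin dfwithout.
    by rewrite dfwithout.
  have lh : linear (fun a => f j (h j a (Y j i1)) : K^o).
    by move=> c a a'; rewrite !hE lB dual_linear.
  apply: exists_dual => //; last exact: ltW.
  apply: bounded_of_ball => // a a1; rewrite (le_trans (f1 _ _))// hM//.
  by rewrite (le_trans (yr _ _))// le_max lexx orbT.
have [g gP] := choice psi.
have [a aP] := choice (fun j => dual_almost_norming (g j)).
have zeta j : exists z : dual_space (G i1), (forall b, z b = f j (h j (a j) b)) /\ rnorm z <= M.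
  have lh : linear (fun b => f j (h j (a j) b) : K^o).
    by move=> c b b'; rewrite /h lB dual_linear.
  apply: exists_dual => //; last exact: ltW.
  apply: bounded_of_ball => // b b1; rewrite (le_trans (f1 _ _))// hM// ?(aP j).1//.
  by rewrite (le_trans b1)// le_max lexx.
have [z zP] := choice zeta.
have zl2 m := cohen_l2 m yc1 M0 (fun j => (zP j).2).
have gu : weakly_unit 2 (fun j => scalar_of k C^-1 *: g j).
  apply: weakly_unit_l2 => m.
  apply: (@le_trans _ _ (\sum_(j < m) (2 / C) ^+ 2 * rnorm (z j (y i1 j)) ^+ 2)).
    apply: ler_sum => j _; rewrite -exprMn lerXn2r ?nnegrE ?mulr_ge0 ?rnorm_ge0 ?invr_ge0 ?(ltW C0)//.
    rewrite rnormZ_real ?invr_ge0 ?(ltW C0)// (mulrC 2) -mulrA ler_pM2l ?invr_gt0//.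
    by rewrite (le_trans (aP j).2)// ler_wpM2l// (gP j).1 (zP j).1.
  rewrite -mulr_sumr; apply: (@le_trans _ _ ((2 / C) ^+ 2 * (c1 * M) ^+ 2)).
    by rewrite ler_wpM2l ?exprn_ge0// divr_ge0// ltW.
  rewrite -exprMn expr_le1// ?mulr_ge0 ?invr_ge0 ?(ltW C0) ?(ltW M0)//.
  by rewrite mulrAC ler_pdivrMr// mul1r /C lerDl.
have := yc0 _ gu N.
rewrite (eq_bigr (fun j : 'I_N => C^-1 * rnorm (f j (B (Y j))))) => [|j _]; last first.
  rewrite -[(_ *: g j) _]/(scalar_of k C^-1 *: g j (y i0 j)).
  rewrite rnormZ_real ?invr_ge0 ?(ltW C0)// (gP j).1; congr (_ * rnorm (f j _)).
  congr B; apply: functional_extensionality_dep => i.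
  have [<-|ii1] := eqVneq i1 i; first by rewrite dfwithin.
  by rewrite dfwithout//; case: (dfwithP _ _ i).
by rewrite -mulr_sumr ler_pdivrMl.
Qed.

(** A single term is a suffix of a partial sum; a large one would contradict the
tail bound. *)
Lemma rad_bounded (V : normedModType K) (x : nat -> V) : Defs.rad x ->
  exists r : R, forall j, rnorm (x j) <= r.
Proof.
move=> /rad_tail[M xM]; exists M%:R => j; rewrite leNgt; apply/negP => big.
(* the tail of the one-term sequence is 1, against 2 / 16 *)
have := tail_suffix (mkseq x j) [:: x j] M%:R.
rewrite cats1 -mkseqS; have := xM j.+1.
rewrite {2}/tail_prob /= sub0r add0r exceedsN /exceeds big /=; lra.
Qed.

Lemma multilinear_comp_cohen_almost_summing (p : R) n
    (E : 'I_n -> completeNormedModType K) (F : completeNormedModType K)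
    (A : (forall i, E i) -> F) :
  1 < p -> (0 < n)%N -> multilinear_comp_cohen p E F A ->
  cohen_almost_summing E F A.
Proof.
move=> p1 n0 [G [u [B [uP cmB AE]]]].
have -> : A = fun x => B (fun i => u i (x i)) by apply/funext => z; exact: AE.
have lu i : linear (u i) by have [] := uP i.
have cu i : continuous (u i) by have [] := uP i.
split; first exact: (continuous_multilinear_comp lu cu cmB).
move=> x xrad.
pose y i j := u i (x i j).
have ysum i : cohen_summable 2 (y i) by exact: cohen_operator_rad (uP i) (xrad i).
have ybound i : exists r, forall j, rnorm (y i j) <= r.
  have [M [M0 uM]] := continuous_linear_bound (lu i) (cu i).
  have [r xr] := rad_bounded (xrad i).
  by exists (M * r) => j; rewrite (le_trans (uM _))// ler_wpM2l.
have [r yr] := choice ybound.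
case: n => [//|[|n]] in E A G u B uP cmB AE lu cu x xrad y ysum ybound r yr n0 *.
  exact: (unilinear_image cmB ysum).
apply: (multilinear_image (y := y) (r := \sum_i `|r i|) (i0 := ord0) (i1 := lift ord0 ord0)) => //.
move=> i j; rewrite (le_trans (yr i j))// (le_trans (ler_norm _))//.
by rewrite (bigD1 i)//= lerDl sumr_ge0.
Qed.

End compositions.

Theorem corollary3p7 (R : realType) (k : scalar_kind) (p : R) (n : nat)
    (p_gt1 : 1 < p) (n_gt0 : (0 < n)%N)
    (E : 'I_n -> completeNormedModType (scalar_field R k))
    (F : completeNormedModType (scalar_field R k)) :
  cohen_multilinear p E F `|` multilinear_comp_cohen p E F
    `<=` cohen_almost_summing E F.
Proof.
move=> A [|]; first exact: cohen_multilinear_almost_summing.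
exact: multilinear_comp_cohen_almost_summing.
Qed.
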